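(* Let $\alpha\in\mathbb{C}$ and let $\mathcal{W}_\alpha=\{W_{a,b}\}_{a,b\in\mathbb{F}_2}$ be the two-sender classical-quantum multiple access channel with coherent-state outputs $$W_{a,b}=|((-1)^a+(-1)^b)\alpha\rangle\langle((-1)^a+(-1)^b)\alpha|.$$ Put $\tilde c_0=(1+e^{-4|\alpha|^2})/2$ and, for $\beta\in\mathbb{C}$, $a_{o|\beta}=e^{-|\beta|^2}\sinh|\beta|^2$ and $a_{\overline e|\beta}=e^{-|\beta|^2}(\cosh|\beta|^2-1)$. Let $\overline{C}_{\mathrm{COMP}}$, $\underline{C}_{\mathrm{COMP}}$ and $\underline{C}_{\mathrm{COMP},\mathrm{on\text{-}off}}$ be the mutual-information quantities defined in the context. Then $$\overline{C}_{\mathrm{COMP}}(\mathcal{W}_\alpha)=h(a_{o|\alpha}),$$ $$\underline{C}_{\mathrm{COMP}}(\mathcal{W}_\alpha)=H\left[\begin{pmatrix}\tilde c_0&\sqrt{a_{\overline e|2\alpha}}\,e^{-2|\alpha|^2}/2&0\\ \sqrt{a_{\overline e|2\alpha}}\,e^{-2|\alpha|^2}/2&a_{\overline e|2\alpha}/2&0\\0&0&a_{o|2\alpha}/2\end{pmatrix}\right]-\frac12h(a_{o|2\alpha}),$$ $$\underline{C}_{\mathrm{COMP},\mathrm{on\text{-}off}}(\mathcal{W}_\alpha)=h(\tilde c_0)-\frac12h(e^{-4|\alpha|^2}).$$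
   Context: **Notation.** $\log$ is to any fixed base, the same throughout. $H[\rho]=-\mathrm{Tr}\,\rho\log\rho$ is the von Neumann entropy of a positive semidefinite matrix or operator, and $h(t)=-t\log t-(1-t)\log(1-t)$ is the binary entropy. The coherent state is $|\beta\rangle=e^{-|\beta|^2/2}\sum_{m\ge0}\frac{\beta^m}{\sqrt{m!}}|m\rangle$ in the Fock space with orthonormal number basis $\{|m\rangle\}_{m\ge0}$. $\oplus,\ominus$ are addition and subtraction in $\mathbb{F}_2$. **Mutual information.** For $X\sim P$ on a finite set and states $\{\rho_x\}$, $I(X;Y)=H[\sum_xP(x)\rho_x]-\sum_xP(x)H[\rho_x]$. **Quantities for a cq-MAC $\mathcal{W}=\{W_{a,b}\}_{a,b\in\mathbb{F}_2}$.** - $\underline{C}_{\mathrm{COMP}}(\mathcal{W})=I(A\oplus B;Y)$ with $A,B$ independent and uniform on $\mathbb{F}_2$, i.e. the mutual information for uniform $X=A\oplus B$ and states $\rho_x=\frac12\sum_{a\in\mathbb{F}_2}W_{a,x\ominus a}$. - $\overline{C}_{\mathrm{COMP}}(\mathcal{W})=\min\big(\max_{P_A,b}I(A;Y|B=b)_{P_A},\ \max_{P_B,a}I(B;Y|A=a)_{P_B}\big)$, where $I(A;Y|B=b)_{P_A}$ is the mutual information for $A\sim P_A$ and states $a\mapsto W_{a,b}$, $I(B;Y|A=a)_{P_B}$ is that for $B\sim P_B$ and states $b\mapsto W_{a,b}$, and the maxima are over distributions on $\mathbb{F}_2$ and over $b$ (resp. $a$) in $\mathbb{F}_2$. - $\underline{C}_{\mathrm{COMP},\mathrm{on\text{-}off}}(\mathcal{W})=I(A\oplus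 B;Z)$, the classical (Shannon) mutual information with $A,B$ independent and uniform on $\mathbb{F}_2$ and $Z$ the outcome of the on-off measurement $\{|0\rangle\langle0|,\ I-|0\rangle\langle0|\}$ (outcome ''off'' for the vacuum projector $|0\rangle\langle 0|$, ''on'' for its complement) applied to $W_{A,B}$. *)

(* Defs.v *)
From HB Require Import structures.
From mathcomp Require Import all_boot all_order all_algebra.
From mathcomp Require Import spectral complex.
From mathcomp Require Import all_classical all_reals all_analysis.

Set Implicit Arguments.
Unset Strict Implicit.
Unset Printing Implicit Defensive.

Import Order.TTheory GRing.Theory Num.Theory.
Import numFieldNormedType.Exports.
Local Open Scope classical_set_scope.
Local Open Scope complex_scope.
Local Open Scope ring_scope.

(* [ln 0 = 0], hence [0 * logb b 0 = 0]. *)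
Definition logb (R : realType) (b t : R) : R := ln t / ln b.

Definition binary_entropy (R : realType) (b t : R) : R :=
  - (t * logb b t) - (1 - t) * logb b (1 - t).

Definition sinh (R : realType) (x : R) : R := (expR x - expR (- x)) / 2.
Definition cosh (R : realType) (x : R) : R := (expR x + expR (- x)) / 2.

(* The modulus as an element of [R]; [`|z|] lives in [R[i]]. *)
Definition modc (R : realType) (z : R[i]) : R := complex.Re `|z|.

(* The (attained) maximum of a set of reals, 0 if there is none. *)
Definition setmax (R : realType) (S : set R) : R :=
  xget 0 [set m | S m /\ ubound S m].

(* [R[i]^o] selects the normed topology of [R[i]] over itself. *)
Definition csum_to (R : realType) (u : nat -> R[i]) (l : R[i]) : Prop :=
  series (u : nat -> R[i]^o) @ \oo --> (l : R[i]^o).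

Definition csum (R : realType) (u : nat -> R[i]) : R[i] :=
  lim (series (u : nat -> R[i]^o) @ \oo).

(* The Fock space is l^2(nat) in its number basis: a vector [v] has the
   coordinates [v m] = <m|v>, an operator [T] the entries [T m n] = <m|T|n>. *)
Definition fvec (R : realType) := nat -> R[i].
Definition fop (R : realType) := nat -> nat -> R[i].

Definition inner (R : realType) (v w : fvec R) : nat -> R[i] :=
  fun m => conjc (v m) * w m.

Definition ketbra (R : realType) (v : fvec R) : fop R :=
  fun m n => v m * conjc (v n).

Definition fop_mul (R : realType) (S T : fop R) : fop R :=
  fun m n => csum (fun k => S m k * T k n).

Definition ftrace (R : realType) (T : fop R) : R[i] :=
  csum (fun n => T n n).

Definition coherent (R : realType) (beta : R[i]) : fvec R := fun m =>
  (expR (- (modc beta ^+ 2 / 2)))%:C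
  * (beta ^+ m / (Num.sqrt (m`!%:R : R))%:C).

(* rho = sum_i lam_i |e_i><e_i| with lam_i >= 0 and orthonormal e_i.  The e_i
   with lam_i = 0 do not contribute to the sum and are left unconstrained, so
   that operators of finite rank need no padding. *)
Definition spectral_decomposition (R : realType) (rho : fop R)
    (lam : nat -> R) (e : nat -> fvec R) : Prop :=
  [/\ forall i, 0 <= lam i,
      forall i j, lam i != 0 -> lam j != 0 ->
        csum_to (inner (e i) (e j)) (i == j)%:R &
      forall m n, csum_to (fun i => (lam i)%:C * ketbra (e i) m n) (rho m n)].

(* rho log rho by functional calculus, for positive trace-class rho; such a rho
   determines the result, whichever spectral decomposition is used. *)
Definition fop_mul_log (R : realType) (b : R) (rho : fop R) : fop R :=
  xget (fun _ _ => 0) [set sigma : fop R | exists lam e,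
    spectral_decomposition rho lam e /\
    forall m n, csum_to
      (fun i => (lam i * logb b (lam i))%:C * ketbra (e i) m n) (sigma m n)].

Definition entropy (R : realType) (b : R) (rho : fop R) : R :=
  - complex.Re (ftrace (fop_mul_log b rho)).

(* Functional calculus along the spectral theorem [orthomx_spectralP]:
   A = invmx P *m diag_mx sp *m P. *)
Definition mx_log (R : realType) (b : R) (n : nat) (A : 'M[R[i]]_n) :
    'M[R[i]]_n :=
  invmx (spectralmx A)
  *m diag_mx (map_mx (fun z => (logb b (complex.Re z))%:C) (spectral_diag A))
  *m spectralmx A.

Definition mx_entropy (R : realType) (b : R) (n : nat) (A : 'M[R[i]]_n) : R :=
  - complex.Re (\tr (A *m mx_log b A)).

Definition is_distr (R : realType) (T : finType) (P : T -> R) : Prop :=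
  (forall x, 0 <= P x) /\ \sum_x P x = 1.

Definition mutual_info (R : realType) (b : R) (T : finType)
    (P : T -> R) (rho : T -> fop R) : R :=
  entropy b (fun m n => \sum_x (P x)%:C * rho x m n)
  - \sum_x P x * entropy b (rho x).

(* Mutual information of a joint probability mass function [J]. *)
Definition shannon_info (R : realType) (b : R) (S T : finType)
    (J : S -> T -> R) : R :=
  \sum_s \sum_t J s t * logb b (J s t / ((\sum_t' J s t') * (\sum_s' J s' t))).

Definition cq_mac (R : realType) := 'F_2 -> 'F_2 -> fop R.

Definition C_lower (R : realType) (b : R) (W : cq_mac R) : R :=
  mutual_info b (fun _ : 'F_2 => 2^-1)
    (fun x m n => 2^-1 * \sum_(a : 'F_2) W a (x - a) m n).

Definition C_upper (R : realType) (b : R) (W : cq_mac R) : R :=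
  Num.min
    (setmax [set v | exists (P : 'F_2 -> R) (y : 'F_2),
       is_distr P /\ v = mutual_info b P (fun x => W x y)])
    (setmax [set v | exists (P : 'F_2 -> R) (x : 'F_2),
       is_distr P /\ v = mutual_info b P (fun y => W x y)]).

(* The outcomes are [false] for off and [true] for on. *)
Definition on_off (R : realType) (z : bool) : fop R := fun m n =>
  let vacuum : R[i] := ((m == 0) && (n == 0))%N%:R in
  if z then (m == n)%:R - vacuum else vacuum.

Definition on_off_prob (R : realType) (rho : fop R) (z : bool) : R :=
  complex.Re (ftrace (fop_mul (on_off R z) rho)).

Definition C_lower_on_off (R : realType) (b : R) (W : cq_mac R) : R :=
  shannon_info b (fun (x : 'F_2) (z : bool) =>
    \sum_(u : 'F_2 * 'F_2 | u.1 + u.2 == x) 4^-1 * on_off_prob (W u.1 u.2) z).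

Definition W_coherent (R : realType) (alpha : R[i]) : cq_mac R := fun x y =>
  ketbra (coherent (((-1) ^+ x + (-1) ^+ y) * alpha)).

Definition c0_tilde (R : realType) (alpha : R[i]) : R :=
  (1 + expR (- (4 * modc alpha ^+ 2))) / 2.

Definition a_odd (R : realType) (beta : R[i]) : R :=
  expR (- modc beta ^+ 2) * sinh (modc beta ^+ 2).

Definition a_even (R : realType) (beta : R[i]) : R :=
  expR (- modc beta ^+ 2) * (cosh (modc beta ^+ 2) - 1).

Definition mx3 (R : realType) (s : seq (seq R)) : 'M[R[i]]_3 :=
  \matrix_(i < 3, j < 3) (nth 0 (nth [::] s i) j)%:C.

(* Main.v *)
(* Every output state of the channel is |2 alpha>, |-2 alpha> or the vacuum.
   Splitting the number basis into {0}, the even m > 0 and the odd m gives three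
   orthonormal vectors with real coordinates (e^{-|beta|^2/2}, sqrt a_e,
   +- sqrt a_o) for |+-beta>, beta = 2 alpha, so each entropy is that of a finite
   hermitian matrix: 3x3 for the average output, and 2x2 with trace 1 for the
   others, where the entropy is h(l) for an eigenvalue l with l(1-l) the
   determinant.  A mixture of the vacuum and |+-2 alpha> with weights p, 1 - p has
   determinant p(1-p)(1-e^{-4|alpha|^2}), which is largest at p = 1/2, and h
   increases on [0, 1/2] by Gibbs' inequality.

   The functional calculus of rho = sum_i mu_i |f_i><f_i| (finite sum) does not
   depend on the spectral decomposition (lam, e) used.  Truncating
   lam_j |<e_j|x>|^2 <= <x|rho|x> and passing to the limit at the component x of
   e_j orthogonal to all f_i shows that e_j lies in the span of the f_i; hence
   only finitely many lam_j are nonzero.  Then rho e_j = lam_j e_j yields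
   lam_j <f_i|e_j> = mu_i <f_i|e_j>, so that phi(lam_j) can be replaced by
   phi(mu_i) in sum_j lam_j phi(lam_j) |e_j><e_j|. *)
Require Import Defs.
From HB Require Import structures.
From mathcomp Require Import all_boot all_order all_algebra.
From mathcomp Require Import spectral complex.
From mathcomp Require Import all_classical all_reals all_analysis.
From mathcomp Require Import ring lra.

Set Implicit Arguments.
Unset Strict Implicit.
Unset Printing Implicit Defensive.

Import Order.TTheory GRing.Theory Num.Theory.
Import numFieldNormedType.Exports.
Local Open Scope classical_set_scope.
Local Open Scope complex_scope.
Local Open Scope ring_scope.

(** * Series of complex numbers *)

Section ComplexSeries.
Variable R : realType.
Implicit Types (u v : nat -> R[i]) (k l : R[i]).

Lemma ReD (x y : R[i]) : complex.Re (x + y) = complex.Re x + complex.Re y.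
Proof. by case: x => a b; case: y. Qed.

Lemma ImD (x y : R[i]) : complex.Im (x + y) = complex.Im x + complex.Im y.
Proof. by case: x => a b; case: y. Qed.

Lemma ReB (x y : R[i]) : complex.Re (x - y) = complex.Re x - complex.Re y.
Proof. by case: x => a b; case: y. Qed.

Lemma ImB (x y : R[i]) : complex.Im (x - y) = complex.Im x - complex.Im y.
Proof. by case: x => a b; case: y. Qed.

Lemma Re_sum (I : Type) (r : seq I) (P : pred I) (F : I -> R[i]) :
  complex.Re (\sum_(i <- r | P i) F i) = \sum_(i <- r | P i) complex.Re (F i).
Proof. by elim/big_rec2: _ => // i x y _ <-; rewrite ReD. Qed.

Lemma Im_sum (I : Type) (r : seq I) (P : pred I) (F : I -> R[i]) :
  complex.Im (\sum_(i <- r | P i) F i) = \sum_(i <- r | P i) complex.Im (F i).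
Proof. by elim/big_rec2: _ => // i x y _ <-; rewrite ImD. Qed.

Lemma Re_realM (x : R) (z : R[i]) : complex.Re (x%:C * z) = x * complex.Re z.
Proof. by case: z => a b /=; rewrite mul0r subr0. Qed.

Lemma norm_Re_le (z : R[i]) : `|complex.Re z|%:C <= `|z|.
Proof. exact: normc_ge_Re. Qed.

Lemma norm_Im_le (z : R[i]) : `|complex.Im z|%:C <= `|z|.
Proof.
rewrite normc_def lecR -sqrtr_sqr; apply: ler_wsqrtr.
by rewrite lerDr sqr_ge0.
Qed.

Lemma norm_le_ReIm (z : R[i]) :
  `|z| <= (`|complex.Re z| + `|complex.Im z|)%:C.
Proof.
rewrite normc_def lecR -[leRHS]ger0_norm ?addr_ge0// -sqrtr_sqr.
apply: ler_wsqrtr; rewrite -(real_normK (num_real (complex.Re z))).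
rewrite -(real_normK (num_real (complex.Im z))).
rewrite sqrrD lerD2r lerDl mulrn_wge0// mulr_ge0//.
Qed.

Lemma cvg_complexP (u : nat -> R[i]^o) (l : R[i]^o) : u @ \oo --> l <->
  (@complex.Re R \o u @ \oo --> complex.Re l) /\
  (@complex.Im R \o u @ \oo --> complex.Im l).
Proof.
split.
- move/cvgrPdist_lt => ul.
  split; apply/cvgrPdist_lt => e e0.
  + have e0' : 0 < (e%:C : R[i]) by rewrite ltcR.
    apply: filterS (ul _ e0') => n /= h.
    rewrite -ltcR; apply: le_lt_trans h.
    by rewrite /= -ReB; exact: norm_Re_le.
  + have e0' : 0 < (e%:C : R[i]) by rewrite ltcR.
    apply: filterS (ul _ e0') => n /= h.
    rewrite -ltcR; apply: le_lt_trans h.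
    by rewrite /= -ImB; exact: norm_Im_le.
- move=> [/cvgrPdist_lt ur /cvgrPdist_lt ui]; apply/cvgrPdist_lt => e e0.
  have e2 : 0 < complex.Re e / 2.
    by move: e0; rewrite ltcE /= => /andP[_ ?]; rewrite divr_gt0.
  have eE : e = (complex.Re e)%:C.
    by rewrite RRe_real// gtr0_real.
  near=> n.
  apply: le_lt_trans (norm_le_ReIm _) _; rewrite [ltRHS]eE ltcR.
  rewrite (splitr (complex.Re e)); apply: ltrD.
  + have : `|complex.Re l - (@complex.Re R \o u) n| < complex.Re e / 2.
      by near: n; exact: ur.
    by rewrite ReB.
  + have : `|complex.Im l - (@complex.Im R \o u) n| < complex.Re e / 2.
      by near: n; exact: ui.
    by rewrite ImB.
Unshelve. all: by end_near. Qed.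

(** Uniqueness of limits and the comparison test can then be taken from real series. *)
Lemma csum_toP u l : csum_to u l <->
  (series (@complex.Re R \o u) @ \oo --> complex.Re l) /\
  (series (@complex.Im R \o u) @ \oo --> complex.Im l).
Proof.
rewrite /csum_to cvg_complexP.
have -> : @complex.Re R \o series (u : nat -> R[i]^o) = series (@complex.Re R \o u).
  by apply/funext => n; rewrite /series /= (Re_sum _ _ (u : nat -> R[i])).
have -> : @complex.Im R \o series (u : nat -> R[i]^o) = series (@complex.Im R \o u).
  by apply/funext => n; rewrite /series /= (Im_sum _ _ (u : nat -> R[i])).
by [].
Qed.

Lemma csum_to_unique u l l' : csum_to u l -> csum_to u l' -> l = l'.
Proof.
move=> /csum_toP[a1 a2] /csum_toP[b1 b2].
apply/eqP; rewrite eq_complex; apply/andP; split; apply/eqP.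
  exact: (cvg_unique _ a1 b1).
exact: (cvg_unique _ a2 b2).
Qed.

Lemma csumE u l : csum_to u l -> csum u = l.
Proof. exact: (@cvg_lim _ (@norm_hausdorff _ _)). Qed.

Lemma eq_csum_to u v l : u =1 v -> csum_to u l -> csum_to v l.
Proof. by move=> /funext ->. Qed.

Lemma csum_toD u v l k : csum_to u l -> csum_to v k ->
  csum_to (fun n => u n + v n) (l + k).
Proof.
move=> /csum_toP[ur ui] /csum_toP[vr vi]; apply/csum_toP; split.
  rewrite ReD (_ : _ \o _ = (@complex.Re R \o u) + (@complex.Re R \o v)).
    by rewrite seriesD; exact: cvgD.
  by apply/funext => n /=; rewrite ReD.
rewrite ImD (_ : _ \o _ = (@complex.Im R \o u) + (@complex.Im R \o v)).
  by rewrite seriesD; exact: cvgD.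
by apply/funext => n /=; rewrite ImD.
Qed.

Lemma csum_toZ k u l : csum_to u l -> csum_to (fun n => k * u n) (k * l).
Proof.
rewrite /csum_to => ul.
have -> : series (fun n => k * u n : R[i]^o) =
    (fun n => (k : R[i]^o) * series (u : nat -> R[i]^o) n).
  by apply/funext => n; rewrite /series /= mulr_sumr.
exact: cvgMl_tmp.
Qed.

Lemma csum_toMr k u l : csum_to u l -> csum_to (fun n => u n * k) (l * k).
Proof.
by move=> /(@csum_toZ k); rewrite mulrC; apply: eq_csum_to => n; rewrite mulrC.
Qed.

Lemma csum_to0 : csum_to (fun=> 0 : R[i]) 0.
Proof.
rewrite /csum_to (_ : series _ = cst 0); first exact: cvg_cst.
by apply/funext => n; rewrite /series /= big1.
Qed.

Lemma csum_to_sum (I : Type) (r : seq I) (P : pred I) (F : I -> nat -> R[i])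
    (l : I -> R[i]) : (forall i, csum_to (F i) (l i)) ->
  csum_to (fun n => \sum_(i <- r | P i) F i n) (\sum_(i <- r | P i) l i).
Proof.
move=> Fl; elim: r => [|i r IH].
  rewrite big_nil; apply: eq_csum_to csum_to0 => n; by rewrite big_nil.
rewrite big_cons; case: ifPn => Pi.
  apply: eq_csum_to (csum_toD (Fl i) IH) => n; by rewrite big_cons Pi.
by apply: eq_csum_to IH => n; rewrite big_cons (negbTE Pi).
Qed.

Lemma csum_to_conj u l : csum_to u l -> csum_to (fun n => conjc (u n)) (conjc l).
Proof.
move=> /csum_toP[ur ui]; apply/csum_toP; split.
  have -> : complex.Re (conjc l) = complex.Re l by case: l {ur ui}.
  have -> // : @complex.Re R \o (fun n => conjc (u n)) = @complex.Re R \o u.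
  by apply/funext => n /=; case: (u n).
have -> : complex.Im (conjc l) = - complex.Im l by case: l {ur ui}.
have -> : @complex.Im R \o (fun n => conjc (u n)) = - (@complex.Im R \o u).
  by apply/funext => n /=; rewrite !fctE /=; case: (u n).
by rewrite seriesN; exact: cvgN.
Qed.

Lemma csum_to_fin N u : (forall n, (N <= n)%N -> u n = 0) ->
  csum_to u (\sum_(n < N) u n).
Proof.
move=> u0; apply/cvgrPdist_lt => e e0; exists N => // n /= Nn.
suff -> : series (u : nat -> R[i]^o) n = \sum_(i < N) u i.
  by rewrite subrr normr0.
rewrite /series /= (big_cat_nat (leq0n N) Nn)/= big_mkord.
rewrite [X in _ + X = _]big_nat_cond [X in _ + X = _]big1 ?addr0//.
by move=> i /andP[/andP[Ni _] _]; rewrite u0.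
Qed.

Lemma csum_to_real (u : nat -> R) (l : R) :
  csum_to (fun n => (u n)%:C) l%:C <-> series u @ \oo --> l.
Proof.
rewrite csum_toP /=; split => [[]|ul]; first by [].
split=> //.
rewrite (_ : _ \o _ = cst 0); last by [].
rewrite (_ : series _ = cst 0); first exact: cvg_cst.
by apply/funext => n; rewrite /series /= big1.
Qed.

Lemma Re_inner_self v n :
  complex.Re (inner v v n) = complex.Re (v n) ^+ 2 + complex.Im (v n) ^+ 2.
Proof. by rewrite /inner; case: (v n) => a b /=; ring. Qed.

Lemma conj_innerE v w n : conjc (inner v w n) = inner w v n.
Proof. by rewrite /inner rmorphM /= conjcK mulrC. Qed.

(** The real and imaginary parts of each term of [inner v w] are bounded by |v_n|^2 + |w_n|^2, since
    2|xy| <= x^2 + y^2, so both series converge absolutely. *)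
Lemma csum_to_inner_ex v w k l :
  csum_to (inner v v) k -> csum_to (inner w w) l ->
  exists c, csum_to (inner v w) c.
Proof.
move=> /csum_toP[vk _] /csum_toP[wl _].
pose B n := complex.Re (inner v v n) + complex.Re (inner w w n).
have Bc : cvgn (series B).
  have -> : B = (@complex.Re R \o inner v v) + (@complex.Re R \o inner w w) by [].
  apply: is_cvg_seriesD; first by apply: cvgP vk.
  by apply: cvgP wl.
have dom (f : nat -> R) : (forall n, `|f n| <= B n) -> cvgn (series f).
  move=> fB; apply: normed_cvg; apply: (series_le_cvg _ _ fB) => //.
  by move=> n; apply: le_trans (fB n).
have /cvg_ex[cr hr] : cvgn (series (@complex.Re R \o inner v w)).
  apply: dom => n; rewrite /B !Re_inner_self /inner /=.
  case: (v n) (w n) => [a b] [c d] /=; rewrite ler_norml; apply/andP; split.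
    have := sqr_ge0 (a + c); have := sqr_ge0 (b + d).
    have := sqr_ge0 a; have := sqr_ge0 b; have := sqr_ge0 c; have := sqr_ge0 d.
    nra.
  have := sqr_ge0 (a - c); have := sqr_ge0 (b - d).
  have := sqr_ge0 a; have := sqr_ge0 b; have := sqr_ge0 c; have := sqr_ge0 d.
  nra.
have /cvg_ex[ci hi] : cvgn (series (@complex.Im R \o inner v w)).
  apply: dom => n; rewrite /B !Re_inner_self /inner /=.
  case: (v n) (w n) => [a b] [c d] /=; rewrite ler_norml; apply/andP; split.
    have := sqr_ge0 (a + d); have := sqr_ge0 (b - c).
    have := sqr_ge0 a; have := sqr_ge0 b; have := sqr_ge0 c; have := sqr_ge0 d.
    nra.
  have := sqr_ge0 (a - d); have := sqr_ge0 (b + c).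
  have := sqr_ge0 a; have := sqr_ge0 b; have := sqr_ge0 c; have := sqr_ge0 d.
  nra.
by exists (cr +i* ci); apply/csum_toP.
Qed.

End ComplexSeries.

Arguments csum_toZ {R} k [u l].
Arguments csum_to0 R : clear implicits.

(** * Functional calculus for finite-rank operators *)

Section FunctionalCalculus.
Variable R : realType.

(** The squared modulus lives in [R], where it can be compared with weights. Being polynomial in the
    two parts, it has limits that follow from those of sums and products. *)
Definition sqmod (z : R[i]) : R := complex.Re z ^+ 2 + complex.Im z ^+ 2.

Lemma sqmod_ge0 z : 0 <= sqmod z.
Proof. by rewrite addr_ge0 ?sqr_ge0. Qed.

Lemma sqmod_eq0 z : sqmod z = 0 -> z = 0.
Proof.
move=> /eqP; rewrite paddr_eq0 ?sqr_ge0// !sqrf_eq0 => /andP[/eqP a /eqP c].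
by apply/eqP; rewrite eq_complex a c !eqxx.
Qed.

Lemma sqmodE z : (sqmod z)%:C = conjc z * z.
Proof.
case: z => a c; rewrite /sqmod.
by apply/eqP; rewrite eq_complex /=; apply/andP; split; apply/eqP; ring.
Qed.

Lemma csum_to_term_le (u : nat -> R) (l : R) j : (forall n, 0 <= u n) ->
  csum_to (fun n => (u n)%:C) l%:C -> u j <= l.
Proof.
move=> u0 /csum_to_real ul.
have nd : nondecreasing_seq (series u) by apply: nondecreasing_series => i _ _.
have : series u j.+1 <= l.
  by rewrite -(cvg_lim _ ul)//; apply: nondecreasing_cvgn_le => //; apply: cvgP ul.
apply: le_trans; rewrite seriesSr lerDr.
by rewrite /series /= sumr_ge0.
Qed.

Lemma cvg_rsum (I : Type) (s : seq I) (F : I -> nat -> R) (l : I -> R) :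
  (forall i, F i @ \oo --> l i) ->
  (fun n => \sum_(i <- s) F i n) @ \oo --> \sum_(i <- s) l i.
Proof.
move=> Fl; elim: s => [|i s IH].
  by rewrite big_nil; under eq_fun do rewrite big_nil; exact: cvg_cst.
rewrite big_cons; under eq_fun do rewrite big_cons.
by apply: cvgD.
Qed.

Lemma cvg_sqmod_series (u : nat -> R[i]) l : csum_to u l ->
  (fun N => sqmod (\sum_(n < N) u n)) @ \oo --> sqmod l.
Proof.
move=> /csum_toP[ur ui].
have -> : (fun N => sqmod (\sum_(n < N) u n)) =
    (fun N => series (@complex.Re R \o u) N * series (@complex.Re R \o u) N
            + series (@complex.Im R \o u) N * series (@complex.Im R \o u) N).
  apply/funext => N; rewrite /sqmod !expr2 Re_sum Im_sum.
  by rewrite /series /= !big_mkord.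
by rewrite /sqmod !expr2; apply: cvgD; apply: cvgM.
Qed.

Lemma sum_kronecker n (i : 'I_n) (c : 'I_n -> R[i]) :
  \sum_k c k * (i == k)%:R = c i.
Proof.
rewrite (bigD1 i) //= eqxx mulr1 big1 ?addr0 // => k ki.
by rewrite eq_sym (negbTE ki) mulr0.
Qed.

Lemma inner_csum_conj (v w : fvec R) l :
  csum_to (inner v w) l -> csum_to (inner w v) (conjc l).
Proof. by move=> /csum_to_conj; apply: eq_csum_to => n; rewrite conj_innerE. Qed.

Variables (b : R) (r : nat) (f : 'I_r -> fvec R) (mu : 'I_r -> R).
Hypothesis mu_ge0 : forall i, 0 <= mu i.
Hypothesis f_orth : forall i j, csum_to (inner (f i) (f j)) (i == j)%:R.
Arguments f_orth : clear implicits.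

Let rho : fop R := fun m n => \sum_i (mu i)%:C * ketbra (f i) m n.

(** * Independence of the spectral decomposition *)

Section Uniqueness.
Variables (lam : nat -> R) (e : nat -> fvec R).
Hypothesis dec : spectral_decomposition rho lam e.

Let lam_ge0 j : 0 <= lam j. Proof. by case: dec. Qed.

Let e_orth i j : lam i != 0 -> lam j != 0 ->
  csum_to (inner (e i) (e j)) (i == j)%:R.
Proof. by case: dec => _ + _; apply. Qed.

Let rhoE m n : csum_to (fun j => (lam j)%:C * ketbra (e j) m n) (rho m n).
Proof. by case: dec. Qed.
Arguments rhoE : clear implicits.

(** The overlap <f_i|e_j>. It is known to be a genuine limit only when [lam j != 0], because e_j is
    arbitrary otherwise; each use assumes this or carries a factor [lam j]. *)
Let C i j : R[i] := csum (inner (f i) (e j)).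

Let CE i j : lam j != 0 -> csum_to (inner (f i) (e j)) (C i j).
Proof.
move=> lj; have [c hc] := csum_to_inner_ex (f_orth i i) (e_orth lj lj).
by rewrite /C (csumE hc).
Qed.
Arguments CE i [j].

Let CEc i j : lam j != 0 -> csum_to (inner (e j) (f i)) (conjc (C i j)).
Proof. by move=> lj; apply: inner_csum_conj; apply: CE. Qed.
Arguments CEc i [j].

(* For finitely supported x this is lam_j |<e_j|x>|^2 <= <x|rho|x>. *)
Lemma weight_quadratic_le (x : fvec R) N j :
  lam j * sqmod (\sum_(n < N) inner (e j) x n)
  <= \sum_i mu i * sqmod (\sum_(n < N) inner (f i) x n).
Proof.
(* The quadratic form of k |v><v| at the truncation of x to its first N coordinates. *)
have qf (v : fvec R) (k : R[i]) :
    \sum_(m < N) \sum_(n < N) conjc (x m) * (k * ketbra v m n) * x n =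
    k * (sqmod (\sum_(n < N) inner v x n))%:C.
  rewrite sqmodE rmorph_sum mulr_suml mulr_sumr; apply: eq_bigr => m _.
  rewrite mulr_sumr mulr_sumr; apply: eq_bigr => n _.
  rewrite /inner /ketbra rmorphM /= conjcK; ring.
apply: (@csum_to_term_le (fun j => lam j * sqmod (\sum_(n < N) inner (e j) x n))).
  by move=> n; rewrite mulr_ge0 ?sqmod_ge0.
(* Only the series over j is infinite: the truncation makes the sums over m and n finite, so they
   commute with it. *)
have h : csum_to (fun j => \sum_(m < N) \sum_(n < N)
      conjc (x m) * ((lam j)%:C * ketbra (e j) m n) * x n)
    (\sum_(m < N) \sum_(n < N) conjc (x m) * rho m n * x n).
  do 2 (apply: csum_to_sum => ?).
  by apply: csum_toMr; apply: csum_toZ; exact: rhoE.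
have -> : (\sum_i mu i * sqmod (\sum_(n < N) inner (f i) x n))%:C =
    \sum_(m < N) \sum_(n < N) conjc (x m) * rho m n * x n.
  rewrite rmorph_sum /=.
  under eq_bigr => i _ do rewrite rmorphM /= -qf.
  rewrite exchange_big /=; apply: eq_bigr => m _.
  rewrite exchange_big /=; apply: eq_bigr => n _.
  by rewrite /rho mulr_sumr mulr_suml.
by apply: eq_csum_to h => k /=; rewrite qf -rmorphM.
Qed.

Lemma eigenvector_in_span j : lam j != 0 ->
  forall m, e j m = \sum_i C i j * f i m.
Proof.
move=> lj.
pose x : fvec R := fun m => e j m - \sum_i C i j * f i m.
have xr (v : fvec R) a c : csum_to (inner v (e j)) a ->
    (forall i, csum_to (inner v (f i)) (c i)) ->
    csum_to (inner v x) (a - \sum_i C i j * c i).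
  move=> va vc; have := csum_toD va (csum_toZ (-1)
    (@csum_to_sum _ _ (index_enum _) xpredT _ _ (fun i => csum_toZ (C i j) (vc i)))).
  rewrite mulN1r; apply: eq_csum_to => n.
  rewrite /inner /x mulN1r mulrBr; congr (_ - _).
  by rewrite mulr_sumr; apply: eq_bigr => i _; rewrite mulrCA.
have fx i : csum_to (inner (f i) x) 0.
  have := xr _ _ _ (CE i lj) (f_orth i).
  by rewrite sum_kronecker subrr.
have [L eL] : exists L, csum_to (inner (e j) x) L.
  by eexists; apply: xr (e_orth lj lj) (fun i => CEc i lj).
(* As N grows, the truncated inequality becomes lam_j |L|^2 <= 0, since x is orthogonal to every
   f_i. *)
have L0 : L = 0.
  apply: sqmod_eq0; apply/eqP; rewrite eq_le sqmod_ge0 andbT.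
  have : lam j * sqmod L <= \sum_i mu i * sqmod 0.
    have lhs : (fun N => lam j * sqmod (\sum_(n < N) inner (e j) x n)) @ \oo
        --> lam j * sqmod L by apply: cvgMl_tmp; exact: cvg_sqmod_series.
    have rhs : (fun N => \sum_i mu i * sqmod (\sum_(n < N) inner (f i) x n))
        @ \oo --> \sum_i mu i * sqmod 0.
      by apply: cvg_rsum => i; apply: cvgMl_tmp; exact: (cvg_sqmod_series (fx i)).
    apply: (ler_cvg_to lhs rhs).
    by apply: nearW => N; exact: weight_quadratic_le.
  rewrite big1; last by move=> i _; rewrite /sqmod /= expr0n /= addr0 mulr0.
  by rewrite pmulr_rle0// lt_neqAle eq_sym lj lam_ge0.
(* <x|x> = <e_j|x> - sum_i conj(C_ij) <f_i|x>, and both parts vanish. *)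
have xx : csum_to (inner x x) 0.
  have := csum_toD eL (csum_toZ (-1)
    (@csum_to_sum _ _ (index_enum _) xpredT _ _
      (fun i => csum_toZ (conjc (C i j)) (fx i)))).
  rewrite L0 big1 ?mulr0 ?addr0; last by move=> i _; rewrite mulr0.
  apply: eq_csum_to => n.
  rewrite mulN1r {3}/inner {2}/x rmorphB /= mulrBl; congr (_ - _).
  rewrite rmorph_sum mulr_suml; apply: eq_bigr => i _.
  by rewrite rmorphM /= /inner mulrA.
move=> m; apply/eqP; rewrite -subr_eq0; apply/eqP; apply: sqmod_eq0.
apply/eqP; rewrite eq_le sqmod_ge0 andbT.
apply: (@csum_to_term_le (fun n => sqmod (x n))) => [n|].
  exact: sqmod_ge0.
by apply: eq_csum_to xx => n; rewrite sqmodE.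
Qed.

(** Expanding e_k in the f_i inside <e_j|e_k> shows that the columns of [C] at nonzero weights are
    orthonormal in dimension r. *)
Lemma overlap_orthonormal j k : lam j != 0 -> lam k != 0 ->
  \sum_i conjc (C i j) * C i k = (j == k)%:R.
Proof.
move=> lj lk; apply: csum_to_unique (e_orth lj lk).
have := @csum_to_sum _ _ (index_enum _) xpredT _ _
  (fun i => csum_toZ (C i k) (CEc i lj)).
under eq_bigr => i _ do rewrite mulrC.
apply: eq_csum_to => n; rewrite {2}/inner (eigenvector_in_span lk) mulr_sumr.
by apply: eq_bigr => i _; rewrite /inner mulrCA.
Qed.

(** A dimension count: the conjugated columns of [C] form the rows of a matrix with r columns and
    full row rank. *)
Lemma size_nonzero_weights (s : seq nat) : uniq s ->
  (forall j, j \in s -> lam j != 0) -> (size s <= r)%N.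
Proof.
move=> us sl.
pose A : 'M[R[i]]_(size s, r) := \matrix_(k, i) conjc (C i (nth 0%N s k)).
have Au : A \is unitarymx.
  apply/unitarymxP/matrixP => k l; rewrite !mxE.
  rewrite (eq_bigr (fun i => conjc (C i (nth 0%N s k)) * C i (nth 0%N s l))).
    by rewrite overlap_orthonormal ?sl ?mem_nth// nth_uniq.
  by move=> i _; rewrite !mxE; congr (_ * _); exact: conjcK.
by rewrite -(mxrank_unitary Au) rank_leq_col.
Qed.

Lemma finitely_many_weights : exists N, forall j, (N <= j)%N -> lam j = 0.
Proof.
apply: contrapT => noN.
have ex N : exists2 j, (N <= j)%N & lam j != 0.
  apply: contrapT => h; apply: noN; exists N => j Nj.
  by apply/eqP; apply: contrapT => /negP lj; apply: h; exists j.
suff [s [us sl ss]] : exists s : seq nat, [/\ uniq s,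
    forall j, j \in s -> lam j != 0 & size s = r.+1].
  by have := size_nonzero_weights us sl; rewrite ss ltnn.
elim: r.+1 => [|n [s [us sl ss]]]; first by exists [::].
(* An index above the maximum of [s] is new, so the list stays duplicate-free. *)
have [j sj lj] := ex (\max_(i <- s) i).+1.
exists (j :: s); split; last by rewrite /= ss.
- rewrite /= us andbT; apply/negP => js.
  by have := @leq_bigmax_seq _ s xpredT id j js isT; rewrite leqNgt sj.
- by move=> k; rewrite inE => /orP[/eqP->//|/sl].
Qed.

Lemma rho_finite_sum : exists N, (forall j, (N <= j)%N -> lam j = 0) /\
  forall m n, rho m n = \sum_(j < N) (lam j)%:C * ketbra (e j) m n.
Proof.
have [N lN] := finitely_many_weights; exists N; split=> // m n.
apply: csum_to_unique (rhoE m n) _.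
apply: (@csum_to_fin _ N (fun j => (lam j)%:C * ketbra (e j) m n)) => j Nj.
by rewrite lN// mul0r.
Qed.

Lemma overlap_eigen i k : lam k != 0 -> (lam k)%:C * C i k = (mu i)%:C * C i k.
Proof.
move=> lk; have [N [lN rE]] := rho_finite_sum.
have kN : (k < N)%N.
  by rewrite ltnNge; apply/negP => /lN; apply/eqP.
(* Two evaluations of rho e_k: the finite sum over the e_j gives lam_k e_k by orthonormality, the
   sum over the f_i gives sum_i mu_i C_ik f_i. Pairing with f_i then isolates one coefficient. *)
have eig m : (lam k)%:C * e k m = \sum_i (mu i)%:C * f i m * C i k.
  apply: (@csum_to_unique _ (fun n => rho m n * e k n)); last first.
    have := @csum_to_sum _ _ (index_enum _) xpredT _ _
      (fun i => csum_toZ ((mu i)%:C * f i m) (CE i lk)).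
    apply: eq_csum_to => n; rewrite /rho mulr_suml; apply: eq_bigr => i' _.
    by rewrite /ketbra /inner !mulrA.
  have h (j : 'I_N) : csum_to (fun n => (lam j)%:C * e j m * inner (e j) (e k) n)
      ((lam j)%:C * e j m * (j == k :> nat)%:R).
    have [l0|lj] := eqVneq (lam j) 0; last by apply: csum_toZ; apply: e_orth.
    rewrite l0 !mul0r; apply: eq_csum_to (csum_to0 R) => n.
    by rewrite !mul0r.
  have := @csum_to_sum _ _ (index_enum _) xpredT _ _ h.
  rewrite (eq_bigr (fun j : 'I_N =>
      (lam j)%:C * e j m * (Ordinal kN == j)%:R)); last first.
    by move=> j _; rewrite eq_sym.
  rewrite sum_kronecker.
  apply: eq_csum_to => n; rewrite rE mulr_suml; apply: eq_bigr => j _.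
  by rewrite /ketbra /inner !mulrA.
apply: (@csum_to_unique _ (fun m => (lam k)%:C * inner (f i) (e k) m)).
  by apply: csum_toZ; exact: CE.
have := @csum_to_sum _ _ (index_enum _) xpredT _ _
  (fun i' => csum_toZ ((mu i')%:C * C i' k) (f_orth i i')).
rewrite sum_kronecker.
apply: eq_csum_to => m.
rewrite /inner mulrCA eig mulr_sumr; apply: eq_bigr => i' _; ring.
Qed.

(** The factor t in t phi(t) removes the terms of weight zero, whose vectors are arbitrary. In the
    application [phi] is [logb b]. *)
Lemma functional_calculus_unique (phi : R -> R) (sigma : fop R) :
  (forall m n, csum_to (fun j => (lam j * phi (lam j))%:C * ketbra (e j) m n)
    (sigma m n)) ->
  forall m n, sigma m n = \sum_i (mu i * phi (mu i))%:C * ketbra (f i) m n.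
Proof.
move=> sE m n; have [N [lN rE]] := rho_finite_sum.
have -> : sigma m n =
    \sum_(j < N) (lam j * phi (lam j))%:C * ketbra (e j) m n.
  apply: csum_to_unique (sE m n) _.
  apply: (@csum_to_fin _ N
    (fun j => (lam j * phi (lam j))%:C * ketbra (e j) m n)) => j Nj.
  by rewrite lN// !mul0r.
(* This is <f_i| rho = mu_i <f_i| at coordinate n, with rho written through the e_j on the left and
   through the f_i on the right. *)
have fr i : \sum_(j < N) (lam j)%:C * C i j * conjc (e j n)
    = (mu i)%:C * conjc (f i n).
  apply: (@csum_to_unique _ (fun m => conjc (f i m) * rho m n)).
    have h (j : 'I_N) : csum_to
        (fun m => (lam j)%:C * conjc (e j n) * inner (f i) (e j) m)
        ((lam j)%:C * conjc (e j n) * C i j).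
      have [l0|lj] := eqVneq (lam j) 0; last by apply: csum_toZ; apply: CE.
      rewrite l0 !mul0r; apply: eq_csum_to (csum_to0 R) => k.
      by rewrite !mul0r.
    have := @csum_to_sum _ _ (index_enum _) xpredT _ _ h.
    under eq_bigr => j _ do rewrite mulrAC.
    apply: eq_csum_to => k; rewrite rE mulr_sumr; apply: eq_bigr => j _.
    by rewrite /ketbra /inner; ring.
  have := @csum_to_sum _ _ (index_enum _) xpredT _ _
    (fun i' => csum_toZ ((mu i')%:C * conjc (f i' n)) (f_orth i i')).
  rewrite sum_kronecker.
  apply: eq_csum_to => k.
  rewrite /rho mulr_sumr; apply: eq_bigr => i' _; rewrite /inner /ketbra; ring.
transitivity (\sum_i (phi (mu i))%:C * f i m *
    \sum_(j < N) (lam j)%:C * C i j * conjc (e j n)); last first.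
  by apply: eq_bigr => i _; rewrite fr /ketbra rmorphM /=; ring.
under [RHS]eq_bigr => i _ do rewrite mulr_sumr.
rewrite exchange_big /=; apply: eq_bigr => j _.
have [l0|lj] := eqVneq (lam j) 0.
  by rewrite l0 !mul0r big1 // => i _; rewrite !mul0r mulr0.
rewrite /ketbra (eigenvector_in_span lj) mulr_suml mulr_sumr.
apply: eq_bigr => i _.
(* Where the overlap is nonzero it can be cancelled in [overlap_eigen], so lam_j = mu_i and [phi]
   takes the same value at both. *)
have [->|Cij] := eqVneq (C i j) 0; first by rewrite !(mulr0, mul0r).
have /complexI -> : (lam j)%:C = (mu i)%:C :> R[i].
  by apply: (mulIf Cij); exact: overlap_eigen.
by rewrite rmorphM /=; ring.
Qed.

End Uniqueness.

Lemma entropy_orthonormal : entropy b rho = - \sum_i mu i * logb b (mu i).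
Proof.
(* The finite family is extended to all indices by weight 0; the padding vectors may be 0, as
   weight-zero vectors are unconstrained. *)
pose lam j := if insub j is Some i then mu i else 0.
pose e j := if insub j is Some i then f i else fun=> 0.
have lamE (i : 'I_r) : lam i = mu i by rewrite /lam valK.
have eE (i : 'I_r) : e i = f i by rewrite /e valK.
have sumE (phi : R -> R) m n : csum_to
    (fun j => (lam j * phi (lam j))%:C * ketbra (e j) m n)
    (\sum_i (mu i * phi (mu i))%:C * ketbra (f i) m n).
  rewrite (eq_bigr (fun i : 'I_r =>
      (lam i * phi (lam i))%:C * ketbra (e i) m n)).
    apply: (@csum_to_fin _ r
      (fun j => (lam j * phi (lam j))%:C * ketbra (e j) m n)) => j rj.
    by rewrite /lam insubN ?mul0r// -leqNgt.
  by move=> i _; rewrite lamE eE.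
have dec : spectral_decomposition rho lam e.
  split.
  - by move=> j; rewrite /lam; case: insub => [i|].
  - move=> j k; rewrite /lam /e.
    case: insubP => [i _ <-|]; last by rewrite eqxx.
    case: insubP => [i' _ <-|]; last by rewrite eqxx.
    by rewrite val_eqE.
  - move=> m n; have := sumE (fun=> 1) m n.
    under eq_bigr => i _ do rewrite mulr1.
    by apply: eq_csum_to => j; rewrite mulr1.
(* The family above shows that the set behind [xget] is inhabited. The chosen operator may come from
   another decomposition, which is why uniqueness is needed. *)
have [lam' [e' [dec' sig]]] : exists lam' e', spectral_decomposition rho lam' e' /\
    forall m n, csum_to
      (fun i => (lam' i * logb b (lam' i))%:C * ketbra (e' i) m n)
      (fop_mul_log b rho m n).
  rewrite /fop_mul_log; case: xgetP => [s _ //|] /(_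
    (fun m n => \sum_i (mu i * logb b (mu i))%:C * ketbra (f i) m n)) [].
  exists lam, e; split=> // m n; exact: sumE.
have sE := functional_calculus_unique dec' sig.
rewrite /entropy /ftrace.
have -> : csum (fun n => fop_mul_log b rho n n)
    = \sum_i (mu i * logb b (mu i))%:C.
  apply: csumE.
  have := @csum_to_sum _ _ (index_enum _) xpredT _ _
    (fun i => csum_toZ (mu i * logb b (mu i))%:C (f_orth i i)).
  under eq_bigr => i _ do rewrite eqxx mulr1.
  apply: eq_csum_to => n; rewrite sE; apply: eq_bigr => i _.
  by rewrite /ketbra /inner [conjc _ * _]mulrC.
by rewrite -(rmorph_sum (real_complex R)).
Qed.

End FunctionalCalculus.

(** * Entropy of finite mixtures of vectors *)

Section MatrixEntropy.
Variables (R : realType) (b : R).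

Lemma conjCE (z : R[i]) : Num.conj z = conjc z. Proof. by []. Qed.

Lemma conjcM (x y : R[i]) : conjc (x * y) = conjc x * conjc y.
Proof. exact: rmorphM. Qed.

Lemma mx_entropy_normal n (M : 'M[R[i]]_n) : M \is normalmx ->
  mx_entropy b M = - \sum_k complex.Re (spectral_diag M 0 k)
                       * logb b (complex.Re (spectral_diag M 0 k)).
Proof.
move=> /orthomx_spectralP ME; rewrite /mx_entropy /mx_log {1}ME.
set P := spectralmx M; set D := spectral_diag M; set L := map_mx _ _.
rewrite !mulmxA mulmxK ?spectral_unit// -mulmxA -mulmxA mxtrace_mulC.
rewrite mulmxA mulmxK ?spectral_unit// mulmx_diag mxtrace_diag Re_sum.
congr (- _); apply: eq_bigr => k _; rewrite !mxE mulrC Re_realM mulrC.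
by [].
Qed.

Lemma mxtrace_spectral n (M : 'M[R[i]]_n) : M \is normalmx ->
  \tr M = \sum_k spectral_diag M 0 k.
Proof.
move=> /orthomx_spectralP ME; rewrite {1}ME -mulmxA mxtrace_mulC mulmxK.
  by rewrite mxtrace_diag.
exact: spectral_unit.
Qed.

Lemma det_spectral n (M : 'M[R[i]]_n) : M \is normalmx ->
  \det M = \prod_k spectral_diag M 0 k.
Proof.
move=> /orthomx_spectralP ME; rewrite {1}ME !det_mulmx mulrC mulrA -det_mulmx.
by rewrite mulmxV ?spectral_unit// det1 mul1r det_diag.
Qed.

Section Mixture.
Variables (r k : nat) (p : 'I_k -> R) (B : 'M[R[i]]_(k, r)).
Hypothesis p_ge0 : forall a, 0 <= p a.

(** The matrix of sum_a p_a |v_a><v_a| in an orthonormal family, where row a of [B] holds the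
    coordinates of v_a. *)
Definition mixture_mx : 'M[R[i]]_r :=
  \matrix_(i, j) \sum_a (p a)%:C * B a i * conjc (B a j).

Lemma mixture_mx_herm : mixture_mx \is hermsymmx.
Proof.
apply/is_hermitianmxP/matrixP => i j; rewrite expr0 scale1r !mxE conjCE.
rewrite rmorph_sum; apply: eq_bigr => a _.
transitivity (conjc ((p a)%:C * B a j * conjc (B a i))) => //.
by rewrite !conjcM conjcK conjc_real mulrAC.
Qed.

Lemma mixture_mx_normal : mixture_mx \is normalmx.
Proof. exact/hermitian_normalmx/mixture_mx_herm. Qed.

Let P := spectralmx mixture_mx.
Let D := spectral_diag mixture_mx.

Let PP1 i j : \sum_l P i l * conjc (P j l) = (i == j)%:R.
Proof.
have /unitarymxP/matrixP/(_ i j) := spectral_unitarymx mixture_mx.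
by rewrite !mxE => <-; apply: eq_bigr => l _; rewrite !mxE.
Qed.

Lemma mixture_spectral_entry i j :
  mixture_mx i j = \sum_l conjc (P l i) * D 0 l * P l j.
Proof.
have /orthomx_spectralP -> := mixture_mx_normal.
rewrite -/P -/D invmx_unitary ?spectral_unitarymx// !mxE.
apply: eq_bigr => l _; congr (_ * _).
by rewrite mul_mx_diag !mxE.
Qed.

(** [P] is unitary, so D_l is the value of the quadratic form of the mixture at the conjugated l-th
    row of [P]. This makes the eigenvalues real and nonnegative. *)
Lemma mixture_spectral_diag l :
  D 0 l = (\sum_a p a * sqmod (\sum_i P l i * B a i))%:C.
Proof.
have -> : D 0 l = (P *m mixture_mx *m invmx P) l l.
  have /orthomx_spectralP -> := mixture_mx_normal.
  rewrite -/P -/D !mulmxA.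
  by rewrite mulmxV ?spectral_unit// mul1mx mulmxK ?spectral_unit// mxE eqxx.
rewrite invmx_unitary ?spectral_unitarymx// !mxE rmorph_sum /=.
under eq_bigr => j _ do rewrite !mxE mulr_suml.
transitivity (\sum_a \sum_j \sum_i
    P l i * ((p a)%:C * B a i * conjc (B a j)) * conjc (P l j)).
  rewrite [RHS]exchange_big; apply: eq_bigr => j _.
  rewrite [RHS]exchange_big; apply: eq_bigr => i _.
  by rewrite /mixture_mx mxE mulr_sumr mulr_suml.
apply: eq_bigr => a _; rewrite rmorphM /= sqmodE rmorph_sum /=.
rewrite mulr_suml mulr_sumr; apply: eq_bigr => j _.
rewrite mulr_sumr mulr_sumr; apply: eq_bigr => i _.
by rewrite rmorphM /=; ring.
Qed.

Lemma mixture_spectral_ge0 l : 0 <= complex.Re (D 0 l).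
Proof.
rewrite mixture_spectral_diag /= sumr_ge0// => a _.
by rewrite mulr_ge0 ?sqmod_ge0.
Qed.

(** The vectors f_l = sum_i conj(P_li) V_i are orthonormal because [P] is unitary, and they
    diagonalise the operator with the eigenvalues of the matrix as weights. Both entropies are
    therefore the same sum. *)
Lemma entropy_mixture (V : 'I_r -> fvec R) :
    (forall i j, csum_to (inner (V i) (V j)) (i == j)%:R) ->
  entropy b (fun m n => \sum_a (p a)%:C
      * ketbra (fun x => \sum_i B a i * V i x) m n)
  = mx_entropy b mixture_mx.
Proof.
move=> Vorth; rewrite mx_entropy_normal ?mixture_mx_normal//.
pose f l : fvec R := fun m => \sum_i conjc (P l i) * V i m.
rewrite -(@entropy_orthonormal _ b _ f
  (fun l => complex.Re (spectral_diag mixture_mx 0 l))); first last.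
- move=> i j; rewrite -(PP1 i j).
  have := @csum_to_sum _ _ (index_enum _) xpredT _ _ (fun l =>
    @csum_to_sum _ _ (index_enum _) xpredT _ _ (fun l' =>
      csum_toZ (P i l * conjc (P j l')) (Vorth l l'))).
  under eq_bigr => l _ do rewrite sum_kronecker.
  apply: eq_csum_to => n.
  rewrite {2}/inner /f rmorph_sum mulr_suml; apply: eq_bigr => l _.
  rewrite mulr_sumr; apply: eq_bigr => l' _.
  by rewrite /inner rmorphM /= conjcK; ring.
- exact: mixture_spectral_ge0.
- congr entropy; apply/funext => m; apply/funext => n.
  transitivity (\sum_i \sum_j V i m * mixture_mx i j * conjc (V j n)).
    transitivity (\sum_a \sum_i \sum_j
        V i m * ((p a)%:C * B a i * conjc (B a j)) * conjc (V j n)).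
      apply: eq_bigr => a _; rewrite /ketbra mulrA mulr_sumr mulr_suml.
      apply: eq_bigr => i _; rewrite rmorph_sum mulr_sumr.
      by apply: eq_bigr => j _; rewrite rmorphM /=; ring.
    rewrite exchange_big; apply: eq_bigr => i _.
    rewrite exchange_big; apply: eq_bigr => j _.
    by rewrite /mixture_mx mxE mulr_sumr mulr_suml.
  transitivity (\sum_l \sum_i \sum_j
      V i m * (conjc (P l i) * D 0 l * P l j) * conjc (V j n)).
    rewrite [RHS]exchange_big; apply: eq_bigr => i _.
    rewrite [RHS]exchange_big; apply: eq_bigr => j _.
    by rewrite mixture_spectral_entry mulr_sumr mulr_suml.
  apply: eq_bigr => l _.
  have -> : (complex.Re (spectral_diag mixture_mx 0 l))%:C = D 0 l.
    by rewrite -/D mixture_spectral_diag.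
  rewrite /ketbra /f mulrA mulr_sumr mulr_suml; apply: eq_bigr => i _.
  rewrite rmorph_sum mulr_sumr.
  by apply: eq_bigr => j _; rewrite rmorphM /= conjcK; ring.
Qed.

End Mixture.
End MatrixEntropy.

(** * Monotonicity of the binary entropy and the entropy of 2x2 density matrices *)

Section BinaryEntropy.
Variables (R : realType) (b : R).
Hypothesis b_gt1 : 1 < b.
Implicit Types x y l q : R.

Lemma binary_entropyC x : binary_entropy b (1 - x) = binary_entropy b x.
Proof. by rewrite /binary_entropy subKr addrC. Qed.

(** For x > 0 this is x times the inequality 1 + ln(y/x) <= y/x. *)
Lemma gibbs_term_le x y : 0 <= x -> 0 < y -> x * ln y <= x * ln x + (y - x).
Proof.
rewrite le_eqVlt => /orP[/eqP <-|x0] y0.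
  by rewrite !mul0r add0r subr0 ltW.
have := expR_ge1Dx (ln (y / x)).
rewrite lnK ?posrE ?divr_gt0// ln_div ?posrE// => h.
rewrite addrC -lerBlDr -mulrBr -(ler_pM2l (x := x^-1)) ?invr_gt0//.
by rewrite mulKf ?gt_eqF// mulrBr mulVf ?gt_eqF// mulrC lerBrDl.
Qed.

(** By Gibbs, h(x) is at most the cross entropy -x ln y - (1 - x) ln(1 - y), up to the base; the
    corrections y - x cancel. The cross entropy is affine in x with slope ln(1 - y) - ln y >= 0, and
    at x = y it equals h(y). *)
Lemma binary_entropy_le x y : 0 <= x -> x <= y -> y <= 2^-1 ->
  binary_entropy b x <= binary_entropy b y.
Proof.
move=> x0 xy y2.
have lb : 0 < ln b by rewrite ln_gt0.
have BE z : binary_entropy b z = (- (z * ln z) - (1 - z) * ln (1 - z)) / ln b.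
  by rewrite /binary_entropy /logb !mulrA -mulNr -mulrBl.
rewrite !BE ler_pM2r ?invr_gt0//.
have [y0|y0] := eqVneq y 0.
  by have -> : x = y by apply/eqP; rewrite eq_le xy y0.
have yp : 0 < y by rewrite lt_neqAle eq_sym y0 (le_trans x0).
have y1 : 0 < 1 - y by lra.
have g1 := gibbs_term_le x0 yp.
have x1 : 0 <= 1 - x by lra.
have g2 := gibbs_term_le x1 y1.
have : ln y <= ln (1 - y) by rewrite ler_ln ?posrE//; lra.
nra.
Qed.

(** Both h and t(1 - t) are invariant under t -> 1 - t and increase on [0, 1/2]. Entropies of 2x2
    density matrices can thus be compared through determinants, without solving for an eigenvalue or
    knowing on which side of 1/2 it lies. *)
Lemma binary_entropy_le_quad l q : 0 <= l <= 1 -> 0 <= q <= 2^-1 ->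
  l * (1 - l) <= q * (1 - q) -> binary_entropy b l <= binary_entropy b q.
Proof.
wlog l2 : l / l <= 2^-1.
  move=> W lb qb lq; have [l2|l2] := leP l 2^-1; first exact: W.
  rewrite -binary_entropyC; apply: W => //; [lra|lra|].
  by rewrite subKr mulrC.
move=> /andP[l0 l1] /andP[q0 q2] lq; apply: binary_entropy_le => //.
by rewrite leNgt; apply/negP => ql; nra.
Qed.

Lemma binary_entropy_eq_quad l q : 0 <= l <= 1 -> 0 <= q <= 2^-1 ->
  l * (1 - l) = q * (1 - q) -> binary_entropy b l = binary_entropy b q.
Proof.
wlog l2 : l / l <= 2^-1.
  move=> W lb qb lq; have [l2|l2] := leP l 2^-1; first exact: W.
  rewrite -binary_entropyC; apply: W => //; [lra|lra|].
  by rewrite subKr mulrC.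
move=> lb qb lq; apply/eqP; rewrite eq_le; apply/andP.
by split; apply: binary_entropy_le_quad => //; [rewrite lq|lra|lra|rewrite lq].
Qed.

(* l is an eigenvalue, the other one being 1 - l. *)
Lemma mixture_entropy2 k (p : 'I_k -> R) (B : 'M[R[i]]_(k, 2)) :
    (forall a, 0 <= p a) -> \tr (mixture_mx p B) = 1 ->
  exists l, [/\ 0 <= l <= 1, (l * (1 - l))%:C = \det (mixture_mx p B) &
    mx_entropy b (mixture_mx p B) = binary_entropy b l].
Proof.
move=> p0 tr1.
have Mn := mixture_mx_normal p B.
have trE := mxtrace_spectral Mn; have detE := det_spectral Mn.
have d0 := mixture_spectral_ge0 B p0.
have dR (t : 'I_2) := mixture_spectral_diag p B t.
rewrite mx_entropy_normal//; move: trE detE d0 dR.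
set D := spectral_diag _ => trE detE d0 dR.
pose d (t : 'I_2) := complex.Re (D 0 t).
have DE (t : 'I_2) : D 0 t = (d t)%:C by rewrite /d dR.
have s1 : d ord0 + d (lift ord0 ord0) = 1.
  apply: (@complexI R); move: trE.
  by rewrite tr1 !big_ord_recl big_ord0 addr0 !DE rmorphD.
have d1E : d (lift ord0 ord0) = 1 - d ord0 by lra.
exists (d ord0); split.
- have := d0 ord0; have := d0 (lift ord0 ord0); rewrite -/(d _) -/(d _) => ? ?.
  by apply/andP; split=> //; lra.
- by rewrite detE !big_ord_recl big_ord0 mulr1 !DE d1E rmorphM.
- rewrite !big_ord_recl big_ord0 addr0 -/(d _) -/(d _) d1E.
  by rewrite /binary_entropy; ring.
Qed.

End BinaryEntropy.

(** * Splitting a vector along a partition of the number basis *)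

Section DisjointSupports.
Variable R : realType.

Lemma csum_to_single n (u : nat -> R[i]) : (forall k, k != n -> u k = 0) ->
  csum_to u (u n).
Proof.
move=> u0; have z k : (n < k)%N -> u k = 0 by move=> nk; rewrite u0 ?gtn_eqF.
have := csum_to_fin z; rewrite big_ord_recr /= big1 ?add0r// => i _.
by rewrite u0 ?ltn_eqF.
Qed.

Lemma inner_disjoint (v w : fvec R) (S : pred nat) :
    (forall m, ~~ S m -> v m = 0) -> (forall m, S m -> w m = 0) ->
  csum_to (inner v w) 0.
Proof.
move=> v0 w0; apply: eq_csum_to (csum_to0 R) => m; rewrite /inner.
by have [/w0 ->|/v0 ->] := boolP (S m); rewrite ?mulr0 ?conjc0 ?mul0r.
Qed.

(* When a = 0 the restriction vanishes and the unit vector is |m0>. *)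
Lemma unit_vector_on (u : fvec R) (S : pred nat) m0 (a : R) : S m0 ->
    csum_to (fun m => (sqmod (u m) * (S m)%:R)%:C) a%:C ->
  exists v : fvec R, [/\ forall m, ~~ S m -> v m = 0,
    csum_to (inner v v) 1 &
    forall m, S m -> u m = (Num.sqrt a)%:C * v m].
Proof.
move=> Sm0 ua.
have t0 n : 0 <= sqmod (u n) * (S n)%:R by rewrite mulr_ge0 ?sqmod_ge0.
have le_a n := csum_to_term_le n t0 ua.
have a0 : 0 <= a by apply: le_trans (le_a 0%N).
have [az|an] := eqVneq a 0.
  exists (fun m => (m == m0)%:R); split.
  - by move=> m; case: eqP => // -> /negP[].
  - have z k : k != m0 -> (k == m0)%:R = 0 :> R[i] by move/negbTE ->.
    have := csum_to_single z; rewrite eqxx; apply: eq_csum_to.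
    by move=> n; rewrite /inner conjc_nat -natrM mulnb andbb.
  - move=> m Sm; rewrite az sqrtr0 mul0r; apply: sqmod_eq0.
    by apply/eqP; rewrite eq_le sqmod_ge0 andbT -az -(mulr1 (sqmod _));
      have := le_a m; rewrite Sm.
have sa : (Num.sqrt a)%:C != 0 :> R[i].
  by rewrite (inj_eq (@complexI R)) sqrtr_eq0 -ltNge lt_neqAle eq_sym an.
exists (fun m => if S m then ((Num.sqrt a)^-1)%:C * u m else 0); split.
- by move=> m /negbTE ->.
- have aV : (a^-1)%:C * a%:C = 1 :> R[i] by rewrite -rmorphM /= mulVf.
  have := csum_toZ (a^-1)%:C ua; rewrite aV.
  apply: eq_csum_to => m; rewrite -rmorphM /= /inner.
  case: (S m); last by rewrite mulr0 mulr0 mulr0.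
  rewrite mulr1 conjcM conjc_real mulrACA -sqmodE -!rmorphM /=.
  by rewrite -invfM -expr2 sqr_sqrtr.
- move=> m ->; rewrite mulrA -rmorphM /= mulfV ?mul1r//.
  by move: sa; rewrite (inj_eq (@complexI R)).
Qed.


(** V_i is the normalised restriction of u to the fibre of [cls] over i, and a_i is the squared norm
    of that restriction. Fibres must be nonempty so that a unit vector exists even where a_i = 0. *)
Lemma orthonormal_decomposition r (u : fvec R) (cls : nat -> nat)
    (a : 'I_r -> R) : (forall m, cls m < r)%N ->
    (forall i : 'I_r, exists m, cls m = i) ->
    (forall i : 'I_r, series (fun m => sqmod (u m) * (cls m == i)%:R)
      @ \oo --> a i) ->
  exists V : 'I_r -> fvec R,
    [/\ forall i j, csum_to (inner (V i) (V j)) (i == j)%:R,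
      forall (i : 'I_r) m, cls m != i -> V i m = 0 &
      forall m, u m = \sum_i (Num.sqrt (a i))%:C * V i m].
Proof.
move=> cls_lt cls_ex ua.
have /choice[V VP] : forall i : 'I_r, exists v : fvec R,
    [/\ forall m, cls m != i -> v m = 0, csum_to (inner v v) 1 &
    forall m, cls m == i -> u m = (Num.sqrt (a i))%:C * v m].
  move=> i; have [m0 m0i] := cls_ex i.
  apply: (@unit_vector_on u (fun m => cls m == i) m0); first exact/eqP.
  exact/csum_to_real/ua.
exists V; split.
- move=> i j; have [<-|ij] := eqVneq i j; first by case: (VP i).
  have [Vi _ _] := VP i; have [Vj _ _] := VP j.
  apply: (@inner_disjoint _ _ (fun m => cls m == i)) => // m /eqP mi.
  by apply: Vj; rewrite mi.
- by move=> i m; case: (VP i) => + _ _; apply.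
- move=> m; rewrite (bigD1 (Ordinal (cls_lt m)))//= big1 ?addr0.
    by case: (VP (Ordinal (cls_lt m))) => _ _; apply.
  move=> i ni; have [Vi _ _] := VP i; rewrite Vi ?mulr0//.
  by apply: contra ni => /eqP h; apply/eqP/val_inj.
Qed.

End DisjointSupports.

(** * Coherent states *)

Section Coherent.
Variable R : realType.
Implicit Types (z beta : R[i]) (x : R).

Lemma modc_sqr z : modc z ^+ 2 = sqmod z.
Proof. by rewrite /modc normc_def /= sqr_sqrtr// sqmod_ge0. Qed.

Lemma sqmodM (y z : R[i]) : sqmod (y * z) = sqmod y * sqmod z.
Proof.
by apply: (@complexI R); rewrite rmorphM /= !sqmodE conjcM mulrACA.
Qed.

Lemma sqmod_real x : sqmod (x%:C : R[i]) = x ^+ 2.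
Proof. by rewrite /sqmod /= expr0n /= addr0. Qed.

Lemma sqmodX z n : sqmod (z ^+ n) = sqmod z ^+ n.
Proof.
elim: n => [|n IH]; last by rewrite !exprS sqmodM IH.
by rewrite !expr0 /sqmod /= expr0n /= expr1n addr0.
Qed.

Lemma sqmod0 : sqmod (0 : R[i]) = 0.
Proof. by rewrite /sqmod /= expr0n /= addr0. Qed.

Lemma sqmodN z : sqmod (- z) = sqmod z.
Proof. by case: z => a c; rewrite /sqmod /= !sqrrN. Qed.

Lemma sqmod_double z : sqmod (2 * z) = 4 * sqmod z.
Proof.
have -> : (2 : R[i]) = (2 : R)%:C by rewrite rmorph_nat.
by rewrite sqmodM sqmod_real; congr (_ * _); ring.
Qed.

(** The photon number is Poisson distributed with mean |beta|^2; [exp_coeff] reduces the norm and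
    parity series to the exponential series. *)
Lemma sqmod_coherent beta m :
  sqmod (coherent beta m) = expR (- sqmod beta) * exp_coeff (sqmod beta) m.
Proof.
rewrite /coherent modc_sqr !sqmodM sqmod_real sqmodX.
rewrite -fmorphV sqmod_real exprVn sqr_sqrtr ?ler0n//.
by rewrite expr2 -expRD; congr (expR _ * _); lra.
Qed.

Lemma coherent0 beta : coherent beta 0 = (expR (- (sqmod beta / 2)))%:C.
Proof.
by rewrite /coherent modc_sqr expr0 fact0 sqrtr1 rmorph1 invr1 !mulr1.
Qed.

Lemma coherent_vacuum m : coherent (0 : R[i]) m = (m == 0)%:R.
Proof.
case: m => [|m]; first by rewrite coherent0 sqmod0 mul0r oppr0 expR0.
by rewrite /coherent expr0n /= mul0r mulr0.
Qed.

Lemma coherentN beta m : coherent (- beta) m = (-1) ^+ m * coherent beta m.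
Proof. by rewrite /coherent !modc_sqr sqmodN (exprNn beta) -mulrA mulrCA. Qed.

Lemma cvg_series_lin (u v w : nat -> R) a c l k :
    series u @ \oo --> l -> series v @ \oo --> k ->
    (forall n, w n = a * u n + c * v n) ->
  series w @ \oo --> a * l + c * k.
Proof.
move=> ul vk wE.
have -> : series w = (fun n => a * series u n + c * series v n).
  by apply/funext => n; rewrite /series /= (eq_bigr _ (fun i _ => wE i))
    big_split !mulr_sumr.
by apply: cvgD; apply: cvgMl_tmp.
Qed.

Lemma cvg_exp_coeff x : series (exp_coeff x) @ \oo --> expR x.
Proof. exact: (is_cvg_series_exp_coeff x). Qed.
Arguments cvg_exp_coeff : clear implicits.

Lemma exp_coeffN x n : exp_coeff (- x) n = (-1) ^+ n * exp_coeff x n.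
Proof. by rewrite /exp_coeff /= (exprNn x) mulrA. Qed.

Lemma cvg_coherent beta :
  series (fun m => sqmod (coherent beta m)) @ \oo --> (1 : R).
Proof.
(* The second series is a placeholder with coefficient 0. *)
have := cvg_series_lin (a := expR (- sqmod beta)) (c := 0)
  (cvg_exp_coeff (sqmod beta)) (cvg_exp_coeff 0).
rewrite mul0r addr0 -expRD addNr expR0; apply.
by move=> n; rewrite sqmod_coherent mul0r addr0.
Qed.
Arguments cvg_coherent : clear implicits.

Lemma cvg_coherent_vacuum beta :
  series (fun m => sqmod (coherent beta m) * (m == 0)%:R) @ \oo
  --> expR (- sqmod beta).
Proof.
apply/csum_to_real; have -> : expR (- sqmod beta) =
    sqmod (coherent beta 0) * (0%N == 0%N)%:R.
  by rewrite sqmod_coherent /exp_coeff /= expr0 fact0 invr1 !mulr1.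
apply: (@csum_to_single R 0
  (fun m => (sqmod (coherent beta m) * (m == 0)%:R)%:C)) => k /negbTE ->.
by rewrite mulr0.
Qed.
Arguments cvg_coherent_vacuum : clear implicits.

Lemma cvg_coherent_nonvacuum beta :
  series (fun m => sqmod (coherent beta m) * (m != 0)%:R) @ \oo
  --> 1 - expR (- sqmod beta).
Proof.
have := cvg_series_lin (a := 1) (c := -1) (cvg_coherent beta)
  (cvg_coherent_vacuum beta).
rewrite mul1r mulN1r; apply => n.
by case: (n == 0%N) => /=; ring.
Qed.
Arguments cvg_coherent_nonvacuum : clear implicits.

(** The indicator of odd n is (1 - (-1)^n)/2, and the sign is absorbed by passing from x to -x in
    [exp_coeff]. *)
Lemma cvg_coherent_odd beta :
  series (fun m => sqmod (coherent beta m) * (odd m)%:R) @ \oo --> a_odd beta.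
Proof.
rewrite /a_odd modc_sqr /sinh.
set x := sqmod beta; rewrite (_ : _ * _ =
  expR (- x) / 2 * expR x + - (expR (- x) / 2) * expR (- x)); last by ring.
apply: cvg_series_lin (cvg_exp_coeff x) (cvg_exp_coeff (- x)) _ => n.
rewrite sqmod_coherent -/x exp_coeffN -signr_odd.
by case: (odd n) => /=; rewrite ?expr1 ?expr0; field.
Qed.
Arguments cvg_coherent_odd : clear implicits.

Lemma cvg_coherent_even beta :
  series (fun m => sqmod (coherent beta m) * (~~ odd m)%:R) @ \oo
  --> 1 - a_odd beta.
Proof.
have := cvg_series_lin (a := 1) (c := -1) (cvg_coherent beta)
  (cvg_coherent_odd beta).
rewrite mul1r mulN1r; apply => n.
by case: (odd n) => /=; ring.
Qed.
Arguments cvg_coherent_even : clear implicits.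

Lemma a_evenE beta : a_even beta = 1 - a_odd beta - expR (- sqmod beta).
Proof.
rewrite /a_even /a_odd modc_sqr /cosh /sinh; set x := sqmod beta.
have := expRxMexpNx_1 x; nra.
Qed.

Lemma a_oddE beta : a_odd beta = (1 - expR (- (2 * sqmod beta))) / 2.
Proof.
rewrite /a_odd modc_sqr /sinh; move: (sqmod beta) => x.
have -> : - (2 * x) = - x + - x by ring.
rewrite expRD.
transitivity ((expR x * expR (- x) - expR (- x) * expR (- x)) / 2).
  by field.
by rewrite expRxMexpNx_1.
Qed.

Lemma cvg_coherent_even_nonvacuum beta :
  series (fun m => sqmod (coherent beta m) * (~~ odd m && (m != 0))%:R) @ \oo
  --> a_even beta.
Proof.
have := cvg_series_lin (a := 1) (c := -1) (cvg_coherent_even beta)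
  (cvg_coherent_vacuum beta).
rewrite mul1r mulN1r a_evenE; apply => n.
by case: n => [|n] /=; [ring|case: (odd n) => /=; ring].
Qed.
Arguments cvg_coherent_even_nonvacuum : clear implicits.

Lemma coherent_unit beta : csum_to (inner (coherent beta) (coherent beta)) 1.
Proof.
have /csum_to_real := cvg_coherent beta.
by apply: eq_csum_to => m; rewrite sqmodE.
Qed.
Arguments coherent_unit : clear implicits.

Lemma a_odd_bounds beta : 0 <= a_odd beta <= 2^-1.
Proof.
rewrite a_oddE; have := expR_gt0 (- (2 * sqmod beta)).
have : expR (- (2 * sqmod beta)) <= 1 by rewrite expR_le1; have := sqmod_ge0 beta; lra.
by move=> ? ?; apply/andP; split; lra.
Qed.

End Coherent.

Arguments cvg_coherent {R}.
Arguments cvg_coherent_vacuum {R}.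
Arguments cvg_coherent_nonvacuum {R}.
Arguments cvg_coherent_odd {R}.
Arguments cvg_coherent_even {R}.
Arguments cvg_coherent_even_nonvacuum {R}.
Arguments coherent_unit {R}.

(** * Sums and determinants in dimensions two and three *)

Lemma sum_ord2 (V : nmodType) (F : 'I_2 -> V) :
  \sum_i F i = F (@Ordinal 2 0 isT) + F (@Ordinal 2 1 isT).
Proof.
rewrite !big_ord_recl big_ord0 addr0.
by congr (F _ + F _); apply: val_inj.
Qed.

Lemma sum_ord3 (V : nmodType) (F : 'I_3 -> V) :
  \sum_i F i =
    F (@Ordinal 3 0 isT) + F (@Ordinal 3 1 isT) + F (@Ordinal 3 2 isT).
Proof.
rewrite !big_ord_recl big_ord0 addr0 addrA.
by congr (F _ + F _ + F _); apply: val_inj.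
Qed.

Lemma det_ord2 (K : comNzRingType) (M : 'M[K]_2) :
  \det M =
    M (@Ordinal 2 0 isT) (@Ordinal 2 0 isT)
      * M (@Ordinal 2 1 isT) (@Ordinal 2 1 isT)
    - M (@Ordinal 2 0 isT) (@Ordinal 2 1 isT)
      * M (@Ordinal 2 1 isT) (@Ordinal 2 0 isT).
Proof.
rewrite (expand_det_row _ (@Ordinal 2 0 isT)) sum_ord2 /cofactor !det_mx11 !mxE.
rewrite /= addn0 addn1 expr0 expr1 mul1r mulN1r mulrN.
by congr (_ * M _ _ - _ * M _ _); apply: val_inj.
Qed.

(** * Entropies of mixtures of coherent states *)

Section CoherentEntropy.
Variables (R : realType) (b : R).
Hypothesis b_gt1 : 1 < b.
Implicit Types (alpha beta : R[i]) (s : seq (seq R)).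

Definition real_mx k r s : 'M[R[i]]_(k, r) :=
  \matrix_(i, j) (nth 0 (nth [::] s i) j)%:C.

Lemma mixture_real_mxE k r (p : seq R) s :
  mixture_mx (fun a : 'I_k => p`_a) (real_mx k r s) =
  \matrix_(i, j) (\sum_(a < k) p`_a * (nth [::] s a)`_i * (nth [::] s a)`_j)%:C.
Proof.
apply/matrixP => i j; rewrite /mixture_mx !mxE rmorph_sum.
by apply: eq_bigr => a _; rewrite !mxE conjc_real -!rmorphM.
Qed.

Lemma entropy_coherent beta : entropy b (ketbra (coherent beta)) = 0.
Proof.
transitivity (entropy b
    (fun m n => \sum_(i < 1) (1 : R)%:C * ketbra (coherent beta) m n)).
  congr entropy; apply/funext => m; apply/funext => n.
  by rewrite big_ord1 mul1r.
rewrite (@entropy_orthonormal _ b 1 (fun=> coherent beta) (fun=> 1)) //.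
  by rewrite big_ord1 /logb ln1 mul0r mulr0 oppr0.
by move=> i j; rewrite !ord1; exact: coherent_unit.
Qed.

Lemma sqrt_expRN (x : R) : Num.sqrt (expR (- x)) = expR (- (x / 2)).
Proof.
have -> : - x = - (x / 2) + - (x / 2) by lra.
by rewrite expRD -expr2 sqrtr_sqr ger0_norm ?expR_ge0.
Qed.

(** A unit vector on {0} is fixed only up to a phase; positivity of <0|beta> forces the phase to be
    1. *)
Lemma vacuum_component beta (v : fvec R) : (forall m, m != 0%N -> v m = 0) ->
    coherent beta 0 = (Num.sqrt (expR (- sqmod beta)))%:C * v 0%N ->
  v = coherent 0.
Proof.
move=> v0 e; apply/funext => m; rewrite coherent_vacuum.
have [->|/v0 ->//] := eqVneq m 0%N.
move: e; rewrite coherent0 sqrt_expRN => /esym e.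
apply: (mulfI (x := (expR (- (sqmod beta / 2)))%:C)); last by rewrite e mulr1.
by rewrite (inj_eq (@complexI R)) gt_eqF// expR_gt0.
Qed.

Lemma expRN_sqmod_le1 beta : expR (- sqmod beta) <= 1.
Proof. by rewrite expR_le1 oppr_le0 sqmod_ge0. Qed.

(** With E = |<0|beta>|^2, the vectors |0> and |beta> have coordinates (1, 0) and (sqrt E, sqrt(1 -
    E)), and the determinant of the mixture is p0 p1 (1 - E). The eigenvalue is left implicit, since
    comparisons use only l(1 - l). *)
Lemma entropy_vacuum_mixture (p0 p1 : R) beta :
    0 <= p0 -> 0 <= p1 -> p0 + p1 = 1 ->
  exists l, [/\ 0 <= l <= 1,
    l * (1 - l) = p0 * p1 * (1 - expR (- sqmod beta)) &
    entropy b (fun m n => p0%:C * ketbra (coherent 0) m n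
                        + p1%:C * ketbra (coherent beta) m n)
      = binary_entropy b l].
Proof.
move=> p0_ge0 p1_ge0 p01; set E := expR (- sqmod beta).
have E1 : E <= 1 := expRN_sqmod_le1 beta.
have E0 : 0 <= E := expR_ge0 _.
have [||i|V [Vorth V0 betaE]] := @orthonormal_decomposition R 2 (coherent beta)
    (fun m => (m != 0%N)) (fun i => [:: E; 1 - E]`_i).
- by move=> m; case: (m == 0%N).
- by case=> -[|[|//]] ?; [exists 0%N|exists 1%N].
- case: i => -[|[|//]] ? /=.
    have -> : (fun m => sqmod (coherent beta m) * ((m != 0%N) == 0 :> nat)%:R) =
        (fun m => sqmod (coherent beta m) * (m == 0%N)%:R).
      by apply/funext => m; case: (m == 0%N).
    exact: cvg_coherent_vacuum.
  have -> : (fun m => sqmod (coherent beta m) * ((m != 0%N) == 1%N :> nat)%:R) =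
      (fun m => sqmod (coherent beta m) * (m != 0%N)%:R).
    by apply/funext => m; case: (m == 0%N).
  exact: cvg_coherent_nonvacuum.
pose c := Num.sqrt E; pose d := Num.sqrt (1 - E).
have c2 : c ^+ 2 = E by rewrite sqr_sqrtr.
have d2 : d ^+ 2 = 1 - E by rewrite sqr_sqrtr// subr_ge0.
pose B := real_mx 2 2 [:: [:: 1; 0]; [:: c; d]].
have V0E : V (@Ordinal 2 0 isT) = coherent 0.
  apply: (@vacuum_component beta).
    by move=> m m0; apply: V0; rewrite m0.
  by rewrite betaE sum_ord2 /= (V0 (@Ordinal 2 1 isT)) ?mulr0 ?addr0.
have rhoE : (fun m n => p0%:C * ketbra (coherent 0) m n
                        + p1%:C * ketbra (coherent beta) m n) =
    (fun m n => \sum_(a < 2) ([:: p0; p1]`_a)%:C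
       * ketbra (fun x => \sum_i B a i * V i x) m n).
  apply/funext => m; apply/funext => n; rewrite sum_ord2 /=.
  congr (_ * ketbra _ _ _ + _ * ketbra _ _ _).
    by apply/funext => x; rewrite sum_ord2 !mxE /= -V0E mul1r mul0r addr0.
  by apply/funext => x; rewrite betaE !sum_ord2 !mxE.
have p_ge0 (a : 'I_2) : 0 <= [:: p0; p1]`_a by case: a => -[|[|//]] ?.
have tr1 : \tr (mixture_mx (fun a : 'I_2 => [:: p0; p1]`_a) B) = 1.
  rewrite mixture_real_mxE /mxtrace sum_ord2 !mxE -rmorphD !sum_ord2 /=.
  by congr (_%:C); nra.
have [l [lb detE hE]] := mixture_entropy2 b p_ge0 tr1.
exists l; split=> //; last by rewrite rhoE entropy_mixture.
apply: (@complexI R); rewrite detE mixture_real_mxE det_ord2 !mxE !sum_ord2 /=.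
by rewrite -!rmorphM -rmorphB; congr (_%:C); rewrite -d2; ring.
Qed.

(** The vectors |beta> and |-beta> have the same even part and opposite odd parts, so the cross
    terms cancel and the matrix is diagonal with entries 1 - [a_odd beta] and [a_odd beta]. *)
Lemma entropy_cat_mixture beta :
  entropy b (fun m n => 2^-1 * (ketbra (coherent beta) m n
                              + ketbra (coherent (- beta)) m n))
  = binary_entropy b (a_odd beta).
Proof.
set ao := a_odd beta; have ao_b := a_odd_bounds beta.
have [||i|V [Vorth V0 betaE]] := @orthonormal_decomposition R 2 (coherent beta)
    (fun m => odd m) (fun i => [:: 1 - ao; ao]`_i).
- by move=> m; case: (odd m).
- by case=> -[|[|//]] ?; [exists 0%N|exists 1%N].
- case: i => -[|[|//]] ? /=.
    have -> : (fun m => sqmod (coherent beta m) * (odd m == 0 :> nat)%:R) =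
        (fun m => sqmod (coherent beta m) * (~~ odd m)%:R).
      by apply/funext => m; case: (odd m).
    exact: cvg_coherent_even.
  have -> : (fun m => sqmod (coherent beta m) * (odd m == 1%N :> nat)%:R) =
      (fun m => sqmod (coherent beta m) * (odd m)%:R).
    by apply/funext => m; case: (odd m).
  exact: cvg_coherent_odd.
pose c := Num.sqrt (1 - ao); pose d := Num.sqrt ao.
have c2 : c ^+ 2 = 1 - ao by rewrite sqr_sqrtr//; rewrite /ao; lra.
have d2 : d ^+ 2 = ao by rewrite sqr_sqrtr//; rewrite /ao; lra.
pose B := real_mx 2 2 [:: [:: c; d]; [:: c; - d]].
have rhoE : (fun m n => 2^-1 * (ketbra (coherent beta) m n
                              + ketbra (coherent (- beta)) m n)) =
    (fun m n => \sum_(a < 2) ([:: 2^-1; 2^-1 : R]`_a)%:C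
       * ketbra (fun x => \sum_i B a i * V i x) m n).
  apply/funext => m; apply/funext => n; rewrite sum_ord2 /= mulrDr.
  have -> : (2^-1 : R[i]) = (2^-1 : R)%:C by rewrite fmorphV rmorph_nat.
  congr (_ * ketbra _ _ _ + _ * ketbra _ _ _).
    by apply/funext => x; rewrite betaE !sum_ord2 !mxE.
  (* The sign (-1)^x fixes the first vector, supported on even numbers, and negates the second,
     supported on odd ones. *)
  apply/funext => x; rewrite coherentN betaE !sum_ord2 !mxE /= -signr_odd.
  have := V0 (@Ordinal 2 0 isT) x; have := V0 (@Ordinal 2 1 isT) x => /=.
  rewrite rmorphN; case: (odd x) => /= v1 v0.
    by rewrite v0// !mulr0 !add0r expr1 mulN1r mulNr.
  by rewrite v1// !mulr0 !addr0 expr0 mul1r.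
have p_ge0 (a : 'I_2) : 0 <= [:: 2^-1; 2^-1 : R]`_a.
  by case: a => -[|[|//]] ? /=; rewrite invr_ge0.
have tr1 : \tr (mixture_mx (fun a : 'I_2 => [:: 2^-1; 2^-1 : R]`_a) B) = 1.
  rewrite mixture_real_mxE /mxtrace sum_ord2 !mxE -rmorphD !sum_ord2 /=.
  by congr (_%:C); nra.
have [l [lb detE hE]] := mixture_entropy2 b p_ge0 tr1.
rewrite rhoE entropy_mixture// hE; apply: binary_entropy_eq_quad => //.
apply: (@complexI R); rewrite detE mixture_real_mxE det_ord2 !mxE !sum_ord2 /=.
rewrite -!rmorphM -rmorphB; congr (_%:C).
by rewrite -c2 -[X in _ = X * _]d2; field.
Qed.

(** The coordinates are (1, 0, 0) for the vacuum and (c, e, o), (c, e, -o) for |beta>, |-beta>, with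
    c = <0|beta>. The two signs of o cancel every entry that couples the odd part to the rest, and
    twice 1/4 gives the factor 1/2 in [od]. *)
Lemma entropy_mac_average beta :
  let c := expR (- (sqmod beta / 2)) in
  let od := Num.sqrt (a_even beta) * c / 2 in
  entropy b (fun m n => 2^-1 * ketbra (coherent 0) m n
    + 4^-1 * (ketbra (coherent beta) m n + ketbra (coherent (- beta)) m n))
  = mx_entropy b (mx3 [:: [:: (1 + c ^+ 2) / 2; od; 0];
                          [:: od; a_even beta / 2; 0];
                          [:: 0; 0; a_odd beta / 2]]).
Proof.
move=> c od; set ao := a_odd beta; set ae := a_even beta.
pose cls m := if odd m then 2 else (m != 0%N) : nat.
have [||i|V [Vorth V0 betaE]] := @orthonormal_decomposition R 3 (coherent beta)
    cls (fun i => [:: expR (- sqmod beta); ae; ao]`_i).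
- by move=> m; rewrite /cls; case: (odd m) => //; case: (m == 0%N).
- by case=> -[|[|[|//]]] ?; [exists 0%N|exists 2%N|exists 1%N].
- case: i => -[|[|[|//]]] ? /=.
  + have -> : (fun m => sqmod (coherent beta m) * (cls m == 0%N)%:R) =
        (fun m => sqmod (coherent beta m) * (m == 0%N)%:R).
      by apply/funext => -[|m]; rewrite /cls //=; case: (odd m).
    exact: cvg_coherent_vacuum.
  + have -> : (fun m => sqmod (coherent beta m) * (cls m == 1%N)%:R) =
        (fun m => sqmod (coherent beta m) * (~~ odd m && (m != 0%N))%:R).
      by apply/funext => -[|m]; rewrite /cls //=; case: (odd m).
    exact: cvg_coherent_even_nonvacuum.
  + have -> : (fun m => sqmod (coherent beta m) * (cls m == 2%N)%:R) =
        (fun m => sqmod (coherent beta m) * (odd m)%:R).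
      by apply/funext => -[|m]; rewrite /cls //=; case: (odd m).
    exact: cvg_coherent_odd.
pose e := Num.sqrt ae; pose o := Num.sqrt ao.
have ao_b := a_odd_bounds beta.
have o2 : o ^+ 2 = ao by rewrite sqr_sqrtr//; rewrite /ao; lra.
have e2 : e ^+ 2 = ae.
  (* Nonnegativity: [a_even beta] equals (1 - exp(-|beta|^2))^2 / 2. *)
  rewrite sqr_sqrtr// /ae a_evenE a_oddE.
  have -> : - (2 * sqmod beta) = - sqmod beta + - sqmod beta by ring.
  rewrite expRD; have := sqr_ge0 (1 - expR (- sqmod beta)); nra.
have V0E : V (@Ordinal 3 0 isT) = coherent 0.
  apply: (@vacuum_component beta).
    by move=> [//|m] _; apply: V0; rewrite /cls; case: ifP.
  rewrite betaE sum_ord3 /= (V0 (@Ordinal 3 1 isT)) ?(V0 (@Ordinal 3 2 isT)) //.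
  by rewrite !mulr0 !addr0.
have {}betaE x : coherent beta x = c%:C * V (@Ordinal 3 0 isT) x
    + e%:C * V (@Ordinal 3 1 isT) x + o%:C * V (@Ordinal 3 2 isT) x.
  by rewrite betaE sum_ord3 /= sqrt_expRN.
pose B := real_mx 3 3 [:: [:: 1; 0; 0]; [:: c; e; o]; [:: c; e; - o]].
have rhoE : (fun m n => 2^-1 * ketbra (coherent 0) m n
    + 4^-1 * (ketbra (coherent beta) m n + ketbra (coherent (- beta)) m n)) =
    (fun m n => \sum_(a < 3) ([:: 2^-1; 4^-1; 4^-1 : R]`_a)%:C
       * ketbra (fun x => \sum_i B a i * V i x) m n).
  apply/funext => m; apply/funext => n; rewrite sum_ord3 /= mulrDr addrA.
  have inv_real k : (k%:R^-1 : R[i]) = (k%:R^-1 : R)%:C.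
    by rewrite fmorphV rmorph_nat.
  rewrite !inv_real.
  congr (_ * ketbra _ _ _ + _ * ketbra _ _ _ + _ * ketbra _ _ _).
  - apply/funext => x; rewrite sum_ord3 !mxE /= -V0E.
    by rewrite mul1r !mul0r !addr0.
  - by apply/funext => x; rewrite betaE !sum_ord3 !mxE.
  - apply/funext => x; rewrite coherentN betaE !sum_ord3 !mxE /= -signr_odd.
    have := V0 (@Ordinal 3 0 isT) x; have := V0 (@Ordinal 3 1 isT) x.
    have := V0 (@Ordinal 3 2 isT) x => /=; rewrite rmorphN /cls.
    case: (odd x) => /= v2 v1 v0.
      by rewrite v0// v1// !mulr0 !add0r expr1 mulN1r mulNr.
    by rewrite v2 ?mulr0 ?addr0 ?expr0 ?mul1r//; case: (x == 0%N).
have p_ge0 (a : 'I_3) : 0 <= [:: 2^-1; 4^-1; 4^-1 : R]`_a.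
  by case: a => -[|[|[|//]]] ? /=; rewrite invr_ge0.
rewrite rhoE (entropy_mixture b B p_ge0 Vorth).
congr mx_entropy; rewrite mixture_real_mxE; apply/matrixP.
have -> : od = e * c / 2 by [].
rewrite -e2 -o2.
by case=> -[|[|[|//]]] ? [] [|[|[|//]]] ?; rewrite !mxE sum_ord3 /=;
  congr (_%:C); field.
Qed.

End CoherentEntropy.

Lemma sum_F2 (V : nmodType) (F : 'F_2 -> V) : \sum_x F x = F 0 + F 1.
Proof.
transitivity (\sum_(i < 2) F i); first by [].
by rewrite sum_ord2; congr (F _ + F _); apply: val_inj.
Qed.

Lemma F2P (P : 'F_2 -> Prop) : P 0 -> P 1 -> forall x, P x.
Proof.
move=> P0 P1 [[|[|//]] h].
  by rewrite (_ : Ordinal h = 0) //; apply: val_inj.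
by rewrite (_ : Ordinal h = 1) //; apply: val_inj.
Qed.

(** * The coherent-state channel *)

Section Channel.
Variables (R : realType) (b : R).
Hypothesis b_gt1 : 1 < b.
Variable alpha : R[i].
Let W := W_coherent alpha.

Lemma W00 : W 0 0 = ketbra (coherent (2 * alpha)).
Proof. by []. Qed.

Lemma W11 : W 1 1 = ketbra (coherent (- (2 * alpha))).
Proof. by rewrite -mulNr opprD. Qed.

Lemma W01 : W 0 1 = ketbra (coherent 0).
Proof. by have <- : (1 - 1) * alpha = 0 by rewrite subrr mul0r. Qed.

Lemma W10 : W 1 0 = ketbra (coherent 0).
Proof. by have <- : (-1 + 1) * alpha = 0 by rewrite addNr mul0r. Qed.

Lemma setmax_eq (S : set R) m : S m -> ubound S m -> setmax S = m.
Proof.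
move=> Sm ub; apply: xget_unique => // m' [Sm' ub'].
by apply/eqP; rewrite eq_le ub// ub'.
Qed.

Lemma entropy_W x y : entropy b (W x y) = 0.
Proof. exact: entropy_coherent. Qed.

Lemma mutual_info_W (P : 'F_2 -> R) (rho : 'F_2 -> fop R) :
  (forall x, entropy b (rho x) = 0) ->
  mutual_info b P rho =
  entropy b (fun m n => (P 0)%:C * rho 0 m n + (P 1)%:C * rho 1 m n).
Proof.
move=> rho0; rewrite /mutual_info big1 ?subr0; last first.
  by move=> x _; rewrite rho0 mulr0.
by congr entropy; apply/funext => m; apply/funext => n; rewrite sum_F2.
Qed.

(** Once one sender is fixed, the other chooses between the vacuum and one of |2 alpha>, |-2 alpha>.
    The bound is p0 p1 <= 1/4, and the second part gives attainment at the uniform input. *)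
Lemma vacuum_mixture_entropy (p0 p1 : R) beta : sqmod beta = 4 * sqmod alpha ->
    0 <= p0 -> 0 <= p1 -> p0 + p1 = 1 ->
  let H := entropy b (fun m n => p0%:C * ketbra (coherent 0) m n
                      + p1%:C * ketbra (coherent beta) m n) in
  H <= binary_entropy b (a_odd alpha) /\
  (p0 = 2^-1 -> H = binary_entropy b (a_odd alpha)).
Proof.
move=> sb p0_ge0 p1_ge0 p01 H.
have [l [lb lE HE]] := entropy_vacuum_mixture b beta p0_ge0 p1_ge0 p01.
have qb := a_odd_bounds alpha.
(* With t = exp(-2|alpha|^2), [a_odd alpha] is (1 - t)/2 and exp(-|beta|^2) is t^2, so both sides
   are (1 - t)(1 + t)/4. *)
have qE : a_odd alpha * (1 - a_odd alpha) = (1 - expR (- sqmod beta)) / 4.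
  rewrite a_oddE sb.
  have -> : - (4 * sqmod alpha) = - (2 * sqmod alpha) + - (2 * sqmod alpha).
    by ring.
  by rewrite expRD; field.
rewrite /H HE; split.
  apply: binary_entropy_le_quad => //; rewrite lE qE.
  have p1E : p1 = 1 - p0 by lra.
  have := expRN_sqmod_le1 beta; have := sqr_ge0 (p0 - 2^-1).
  rewrite p1E; nra.
move=> p0E; apply: binary_entropy_eq_quad => //; rewrite lE qE.
have -> : p1 = 2^-1 by lra.
by rewrite p0E; field.
Qed.

(** Stated for an arbitrary family so that it applies to the channel and to its transpose. The
    disjunction is there because the fixed input decides which input of the other sender yields the
    vacuum. *)
Lemma setmax_vacuum_mixture (rho : 'F_2 -> 'F_2 -> fop R) :
    (forall x y, entropy b (rho x y) = 0) ->
    (forall y, exists beta, sqmod beta = 4 * sqmod alpha /\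
      ((rho 0 y = ketbra (coherent 0) /\ rho 1 y = ketbra (coherent beta)) \/
       (rho 1 y = ketbra (coherent 0) /\ rho 0 y = ketbra (coherent beta)))) ->
  setmax [set v | exists (P : 'F_2 -> R) (y : 'F_2),
       is_distr P /\ v = mutual_info b P (fun x => rho x y)]
  = binary_entropy b (a_odd alpha).
Proof.
move=> rho0 rhoE; apply: setmax_eq.
  exists (fun=> 2^-1), 0; split.
    by split=> [x|]; [rewrite invr_ge0|rewrite sum_F2; lra].
  rewrite mutual_info_W//; have [beta [sb rE]] := rhoE 0.
  have h0 : 0 <= (2^-1 : R) by rewrite invr_ge0.
  have h1 : (2^-1 : R) + 2^-1 = 1 by lra.
  have [_ /(_ erefl) <-] := vacuum_mixture_entropy sb h0 h0 h1.
  case: rE => -[-> ->]; first reflexivity.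
  apply: (congr1 (entropy b)); apply/funext => m; apply/funext => n.
  exact: addrC.
move=> v [P [y [[P0 P1] ->]]]; rewrite mutual_info_W//.
move: P1; rewrite sum_F2 => P1.
have [beta [sb rE]] := rhoE y; case: rE => -[-> ->].
  by have [] := vacuum_mixture_entropy sb (P0 0) (P0 1) P1.
rewrite addrC in P1; have [+ _] := vacuum_mixture_entropy sb (P0 1) (P0 0) P1.
apply: le_trans; rewrite le_eqVlt; apply/orP; left; apply/eqP.
apply: (congr1 (entropy b)); apply/funext => m; apply/funext => n.
exact: addrC.
Qed.

Lemma C_upper_coherent : C_upper b W = binary_entropy b (a_odd alpha).
Proof.
have s2 := sqmod_double alpha; have sN := sqmodN (2 * alpha).
have rhoA (y : 'F_2) : exists beta, sqmod beta = 4 * sqmod alpha /\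
    ((W 0 y = ketbra (coherent 0) /\ W 1 y = ketbra (coherent beta)) \/
     (W 1 y = ketbra (coherent 0) /\ W 0 y = ketbra (coherent beta))).
  elim/F2P: y.
    by exists (2 * alpha); split; [exact: s2|right; rewrite W00 W10].
  exists (- (2 * alpha)); split; first by rewrite sN.
  by left; rewrite W01 W11.
have rhoB (x : 'F_2) : exists beta, sqmod beta = 4 * sqmod alpha /\
    ((W x 0 = ketbra (coherent 0) /\ W x 1 = ketbra (coherent beta)) \/
     (W x 1 = ketbra (coherent 0) /\ W x 0 = ketbra (coherent beta))).
  elim/F2P: x.
    by exists (2 * alpha); split; [exact: s2|right; rewrite W00 W01].
  exists (- (2 * alpha)); split; first by rewrite sN.
  by left; rewrite W10 W11.
have mA := @setmax_vacuum_mixture W entropy_W rhoA.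
have mB := @setmax_vacuum_mixture (fun y x => W x y)
  (fun y x => entropy_W x y) rhoB.
by rewrite -[RHS]minxx -[in X in _ = Num.min X _]mA -[in X in _ = Num.min _ X]mB.
Qed.

Lemma C_lower_coherent :
  let od := Num.sqrt (a_even (2 * alpha)) * expR (- (2 * modc alpha ^+ 2)) / 2 in
  C_lower b W =
    mx_entropy b (mx3 [:: [:: c0_tilde alpha; od; 0];
                          [:: od; a_even (2 * alpha) / 2; 0];
                          [:: 0; 0; a_odd (2 * alpha) / 2]])
    - 2^-1 * binary_entropy b (a_odd (2 * alpha)).
Proof.
move=> od; pose rho (x : 'F_2) : fop R :=
  fun m n => 2^-1 * \sum_(a : 'F_2) W a (x - a) m n.
rewrite /C_lower -/rho /mutual_info [X in _ - X]sum_F2.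
have s00 : (0 - 0 : 'F_2) = 0 by exact/val_inj.
have s01 : (0 - 1 : 'F_2) = 1 by exact/val_inj.
have s10 : (1 - 0 : 'F_2) = 1 by exact/val_inj.
have s11 : (1 - 1 : 'F_2) = 0 by exact/val_inj.
(* Sum 0 leaves an equal mixture of |2 alpha> and |-2 alpha>, while sum 1 always gives the vacuum,
   whose entropy is 0. *)
have r0 : rho 0 = fun m n => 2^-1 * (ketbra (coherent (2 * alpha)) m n
    + ketbra (coherent (- (2 * alpha))) m n).
  apply/funext => m; apply/funext => n.
  by rewrite /rho sum_F2 s00 s01 W00 W11.
have r1 : rho 1 = ketbra (coherent 0).
  apply/funext => m; apply/funext => n.
  by rewrite /rho sum_F2 s10 s11 W01 W10; field.
rewrite r0 r1 (entropy_cat_mixture b_gt1) entropy_coherent mulr0 addr0.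
congr (_ - _).
have eE : expR (- (2 * modc alpha ^+ 2)) =
    expR (- (sqmod (2 * alpha) / 2)).
  by rewrite modc_sqr sqmod_double; congr (expR (- _)); field.
have cE : c0_tilde alpha = (1 + expR (- (sqmod (2 * alpha) / 2)) ^+ 2) / 2.
  rewrite /c0_tilde modc_sqr sqmod_double -expRM_natl.
  by congr ((1 + expR _) / 2); field.
rewrite cE /od eE -entropy_mac_average; congr entropy.
apply/funext => m; apply/funext => n; rewrite sum_F2 r0 r1.
have -> : (2^-1 : R)%:C = 2^-1 :> R[i] by rewrite fmorphV rmorph_nat.
by field.
Qed.

Lemma on_off_prob_coherent (beta : R[i]) (z : bool) :
  on_off_prob (ketbra (coherent beta)) z =
  if z then 1 - expR (- sqmod beta) else expR (- sqmod beta).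
Proof.
(* The measurement operators are diagonal, and [z (+) (n == 0)] is the indicator that photon number
   n produces outcome z. *)
have diag n : fop_mul (on_off R z) (ketbra (coherent beta)) n n
    = (sqmod (coherent beta n) * (z (+) (n == 0%N))%:R)%:C.
  pose u k := on_off R z n k * ketbra (coherent beta) k n.
  have u0 k : k != n -> u k = 0.
    rewrite /u /on_off eq_sym => kn; rewrite (negbTE kn).
    have -> : ((n == 0%N) && (k == 0%N)) = false.
      by apply: contraNF kn => /andP[/eqP -> /eqP ->].
    by clear u; case: z; rewrite ?subrr mul0r.
  rewrite /fop_mul (csumE (csum_to_single u0)) /u /on_off /ketbra eqxx andbb.
  rewrite (rmorphM (real_complex R)) (rmorph_nat (real_complex R)).
  rewrite [RHS](_ : _ = conjc (coherent beta n) * coherent beta n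
    * (z (+) (n == 0%N))%:R); last by rewrite -sqmodE.
  by clear u u0; case: z; case: (n == 0%N) => /=; ring.
rewrite /on_off_prob /ftrace; set L := if z then _ else _.
have h : csum_to (fun n => fop_mul (on_off R z) (ketbra (coherent beta)) n n)
    L%:C.
  apply: eq_csum_to (fun n => esym (diag n)) _; apply/csum_to_real.
  rewrite /L; case: (z); [|exact: cvg_coherent_vacuum].
  exact: cvg_coherent_nonvacuum.
by rewrite (csumE h).
Qed.

Lemma sum_F2_pairs (F : 'F_2 * 'F_2 -> R) (x : 'F_2) :
  \sum_(u | u.1 + u.2 == x) F u =
  if x == 0 then F (0, 0) + F (1, 1) else F (0, 1) + F (1, 0).
Proof.
transitivity (\sum_(i : 'F_2) \sum_(j : 'F_2)
    if i + j == x then F (i, j) else 0).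
  by rewrite big_mkcond pair_bigA; apply: eq_bigr => -[i j].
rewrite !sum_F2.
by elim/F2P: x => /=; rewrite ?addr0 ?add0r.
Qed.

Lemma logb_div (s t : R) : 0 < s -> 0 < t -> logb b (s / t) = logb b s - logb b t.
Proof. by move=> s0 t0; rewrite /logb ln_div ?posrE// mulrBl. Qed.

Lemma C_lower_on_off_coherent :
  C_lower_on_off b W = binary_entropy b (c0_tilde alpha)
    - 2^-1 * binary_entropy b (expR (- (4 * modc alpha ^+ 2))).
Proof.
rewrite modc_sqr /c0_tilde modc_sqr; set q := expR _.
(* The joint law: given sum 0 the outcome is off with probability q, given sum 1 it is always
   off. *)
pose J (x : 'F_2) (z : bool) : R :=
  if x == 0 then (if z then (1 - q) / 2 else q / 2)
  else (if z then 0 else 2^-1).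
have JE : (fun x z => \sum_(u : 'F_2 * 'F_2 | u.1 + u.2 == x)
    4^-1 * on_off_prob (W u.1 u.2) z) = J.
  apply/funext => x; apply/funext => z; rewrite sum_F2_pairs /= /J.
  rewrite W00 W11 W01 W10 !on_off_prob_coherent sqmodN sqmod_double sqmod0.
  rewrite oppr0 expR0 -/q.
  by case: (x == 0); case: z; field.
rewrite /C_lower_on_off JE {JE} /shannon_info sum_F2 !big_bool /= !sum_F2 /J /=.
have q0 : 0 < q := expR_gt0 _.
have q1 : q <= 1 by rewrite expR_le1 oppr_le0 mulr_ge0// sqmod_ge0.
(* The marginal probability of off, which is [c0_tilde alpha]. *)
pose c := (1 + q) / 2.
have c0 : 0 < c by rewrite /c; lra.
have -> : q / 2 / (((1 - q) / 2 + q / 2) * (q / 2 + 2^-1)) = q / c.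
  by rewrite /c; field; lra.
have -> : 2^-1 / ((0 + 2^-1) * (q / 2 + 2^-1)) = 1 / c.
  by rewrite /c; field; lra.
have -> : logb b (q / c) = logb b q - logb b c by exact: logb_div.
have -> : logb b (1 / c) = - logb b c.
  by rewrite logb_div// {1}/logb ln1 mul0r sub0r.
(* If q = 1, that is alpha = 0, the logarithm cannot be split as a quotient of positive numbers, but
   its coefficient vanishes. *)
set T := logb b (_ / _); have -> : (1 - q) / 2 * T =
    (1 - q) / 2 * (logb b (1 - q) - logb b (1 - c)).
  have [->|q_neq1] := eqVneq q 1; first by rewrite subrr !mul0r.
  have q_lt1 : 0 < 1 - q by rewrite subr_gt0 lt_neqAle q_neq1.
  rewrite -logb_div//; last by rewrite /c; lra.
  by congr (_ * logb b _); rewrite /c; field; lra.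
rewrite /binary_entropy -/c.
(* Outcome on arises only from sum 0, so its marginal equals its joint probability. *)
have -> : 1 - c = (1 - q) / 2 by rewrite /c; field.
by move: (logb b c) => Lc; rewrite /c; field.
Qed.

End Channel.

Theorem mainTheorem2 (R : realType) (b : R) (hb : 1 < b) (alpha : R[i]) :
  let h := binary_entropy b in
  let W := W_coherent alpha in
  let od := Num.sqrt (a_even (2 * alpha)) * expR (- (2 * modc alpha ^+ 2)) / 2 in
  [/\ C_upper b W = h (a_odd alpha),
      C_lower b W =
        mx_entropy b (mx3 [:: [:: c0_tilde alpha; od; 0];
                              [:: od; a_even (2 * alpha) / 2; 0];
                              [:: 0; 0; a_odd (2 * alpha) / 2]])
        - 2^-1 * h (a_odd (2 * alpha)) &
      C_lower_on_off b W =
        h (c0_tilde alpha) - 2^-1 * h (expR (- (4 * modc alpha ^+ 2)))].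
Proof.
split.
- exact: C_upper_coherent.
- exact: C_lower_coherent.
- exact: C_lower_on_off_coherent.
Qed.
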